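(* Let $n\ge2$ and let $w\in C^2(B(0,2)\setminus\{0\})$ be nonnegative and satisfy $-\Delta_n w=f(x,w,\nabla w)$ in $B(0,2)\setminus\{0\}\subset\mathbb{R}^n$, with $\lim_{x\to0}w(x)=+\infty$, where $f$ satisfies \[ 0\le f(x,w,\nabla w)\le C|\nabla w|^{n-2}e^{2w} \] for some fixed constant $C$. Then \[ \lim_{x\to0}\frac{w(x)}{\log\frac1{|x|}}=m\ge 0 \] and there is a constant $L$ with $w(x)\ge m\log\frac1{|x|}-L$ for $x\in B(0,1)\setminus\{0\}$.
   Context: $\Delta_n u=\mathrm{div}(|\nabla u|^{n-2}\nabla u)$ is the $n$-Laplacian. *)

(* Defs.v *)
From HB Require Import structures.
From mathcomp Require Import all_boot all_order all_algebra.
From mathcomp Require Import all_classical all_reals all_analysis.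
Set Implicit Arguments. Unset Strict Implicit. Unset Printing Implicit Defensive.
Import Order.TTheory GRing.Theory Num.Theory.
Import numFieldNormedType.Exports.
Local Open Scope ring_scope.

(* Euclidean norm on R^n (the library norm on 'rV is the sup norm). *)
Definition enorm {R : realType} {n : nat} (x : 'rV[R]_n) : R :=
  Num.sqrt (\sum_(i < n) x 0 i ^+ 2).

Definition ebasis {R : realType} {n : nat} (i : 'I_n) : 'rV[R]_n := delta_mx 0 i.

Definition partial {R : realType} {n : nat} (i : 'I_n) (f : 'rV[R]_n -> R)
  (x : 'rV[R]_n) : R := 'D_(ebasis i) f x.

Definition grad {R : realType} {n : nat} (f : 'rV[R]_n -> R) (x : 'rV[R]_n)
  : 'rV[R]_n := \row_(i < n) partial i f x.

Definition C2_on {R : realType} {n : nat} (U : set 'rV[R]_n)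
  (f : 'rV[R]_n -> R) : Prop :=
  forall x, U x ->
    differentiable f x /\
    (forall i, differentiable (partial i f) x) /\
    (forall i j, {for x, continuous (partial j (partial i f))}).

Definition nflux {R : realType} {n : nat} (w : 'rV[R]_n -> R) (i : 'I_n)
  (y : 'rV[R]_n) : R := enorm (grad w y) ^+ (n - 2) * partial i w y.

Definition nlap_defined {R : realType} {n : nat} (w : 'rV[R]_n -> R)
  (x : 'rV[R]_n) : Prop :=
  forall i : 'I_n, derivable (nflux w i) x (ebasis i).

Definition nlap {R : realType} {n : nat} (w : 'rV[R]_n -> R) (x : 'rV[R]_n) : R :=
  \sum_(i < n) partial i (nflux w i) x.

Definition pball {R : realType} {n : nat} (r : R) : set 'rV[R]_n :=
  [set x | 0 < enorm x < r].

(* Main.v *)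
(* Where its gradient [p] does not vanish, [w] satisfies
   [- C e^(2 w) <= op w <= 0] for [op w = Lap w + (n - 2) D^2 w (p, p) / |p|^2], and
   nothing else about the equation is needed.

   Comparison with [b - a ln |x|] makes [phi t = min {w x : |x| = e^(- t)}] concave
   in [t]; being nonnegative it is nondecreasing, its slopes decrease to some
   [m >= 0], and [phi t >= m t], which is the lower bound, with [L = 0].

   For the upper bound suppose [w c >= (m + del) T] with [T = - ln |c|] large.  Near
   [c] there is a spike [x0], [w x0 >= w c], on whose scale [e^(- w x0)] the
   equation, rescaled, has bounded right-hand side; a Hoelder estimate gives
   [w >= (1 - del') w x0] on a ball around [x0] of radius [s] comparable to that
   scale up to powers of [|c|].  Around [x0], [w] therefore dominates a logarithm
   whose slope is bounded below, since its height is at least a fixed fraction of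
   [w x0] while [ln (1 / s)] is at most a multiple of [w x0].  Hence [w] exceeds
   [phi T] by a fixed amount on a whole ball [B(c, eta |c|)].  This contradicts the
   strong maximum principle: [w] lies above [phi T + m ln (|c| / |x|)] up to [o(1)]
   and touches it on [|x| = |c|]. *)

Require Import Defs.
From HB Require Import structures.
From mathcomp Require Import all_boot all_order all_algebra.
From mathcomp Require Import all_classical all_reals all_analysis.
From mathcomp Require Import ring lra.
Import Order.TTheory GRing.Theory Num.Theory.
Import numFieldNormedType.Exports.
Local Open Scope ring_scope.
Local Open Scope classical_set_scope.
Set Implicit Arguments.
Unset Strict Implicit.

(** * Second-order expansions *)

(** At a critical point of [w] the equation does not control the Hessian. So [w] is only ever
    touched from below by barriers whose gradient does not vanish, and each comparison reduces to
    second-order expansions along lines at one interior minimum.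

    The strong maximum principle has to be quantitative: the lower bound on [w] holds only up to an
    error, so the gain must not depend on [c]. The barrier perturbs m ln (1 / |x|), where the
    operator linearizes to a multiple of Lap + (n - 2) d_rr with factor m^2 / |x|^2. This
    degenerates at m = 0, a case treated separately with a plain logarithm, [phi] then being almost
    constant.

    The constants are not circular. The logarithm around a spike runs from radius s = sig rho e^(- w
    x0) / 2 to 4 rho, and ln (4 rho / s) = w x0 + ln 8 - ln sig is free of rho. Its slope is thus at
    least del / (4 (m + del)) whatever the ratio eta = rho / |c|. This fixes the excess; eta and the
    tolerance for near minima are chosen after it, and |c| last. *)

Section Jets.
Context {R : realType}.
Implicit Types (g F : R -> R) (a b c : R).

(** Here [c] is half the second derivative. The limit is along full neighbourhoods, so [r 0 = 0];
    this lets remainders be composed even where the inner increment vanishes. *)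
Definition jet2 g a b c : Prop :=
  exists2 r : R -> R, r t @[t --> (0 : R)] --> (0 : R) &
    forall t, g t = a + b * t + (c + r t) * t ^+ 2.

Lemma near0I (P : R -> Prop) d : 0 < d -> (forall t, `|t| < d -> P t) ->
  \forall t \near (0 : R), P t.
Proof. by move=> d0 dP; apply/nbhs_norm0P; exists d. Qed.

Lemma jet2_ext g g' a b c a' b' c' : jet2 g a b c ->
  g =1 g' -> a = a' -> b = b' -> c = c' -> jet2 g' a' b' c'.
Proof. by case=> r r0 rE gg <- <- <-; exists r => // t; rewrite -gg. Qed.

Lemma jet2_quad a b c : jet2 (fun t => a + b * t + c * t ^+ 2) a b c.
Proof. by exists (fun=> 0) => [|t]; [exact: cvg_cst | rewrite addr0]. Qed.

Lemma jet2_cst a : jet2 (fun=> a) a 0 0.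
Proof. by apply: (jet2_ext (jet2_quad a 0 0)) => // t; ring. Qed.

Lemma jet2D g a b c g' a' b' c' : jet2 g a b c -> jet2 g' a' b' c' ->
  jet2 (fun t => g t + g' t) (a + a') (b + b') (c + c').
Proof.
case=> r r0 rE [r' r'0 rE']; exists (fun t => r t + r' t).
  by rewrite -[X in _ --> X](addr0 (0 : R)); exact: cvgD.
by move=> t; rewrite rE rE'; ring.
Qed.

Lemma jet2Z k g a b c : jet2 g a b c ->
  jet2 (fun t => k * g t) (k * a) (k * b) (k * c).
Proof.
case=> r r0 rE; exists (fun t => k * r t).
  by rewrite -[X in _ --> X](mulr0 k); apply: cvgM => //; exact: cvg_cst.
by move=> t; rewrite rE; ring.
Qed.

Lemma jet2N g a b c : jet2 g a b c -> jet2 (fun t => - g t) (- a) (- b) (- c).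
Proof. by move=> /(jet2Z (-1)) H; apply: (jet2_ext H) => [t|||]; ring. Qed.

Lemma jet2_comp F a (F0 F1 F2 : R) g b c :
  jet2 (fun s => F (a + s)) F0 F1 F2 -> jet2 g a b c ->
  jet2 (fun t => F (g t)) F0 (F1 * b) (F1 * c + F2 * b ^+ 2).
Proof.
case=> q q0 qE [r r0 rE].
have i0 : t @[t --> (0 : R)] --> (0 : R) by exact: cvg_id.
pose u t := b + (c + r t) * t.
have u0 : u t @[t --> (0 : R)] --> b.
  rewrite -[X in _ --> X](_ : b + (c + 0) * 0 = b); last by ring.
  apply: cvgD; first exact: cvg_cst.
  by apply: cvgM => //; apply: cvgD => //; exact: cvg_cst.
pose s t := t * u t.
have s0 : s t @[t --> (0 : R)] --> (0 : R).
  by rewrite -[X in _ --> X](mul0r b); exact: cvgM.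
exists (fun t => F1 * r t + F2 * (u t * u t - b * b) + q (s t) * (u t * u t)).
  rewrite -[X in _ --> X](_ : F1 * 0 + F2 * (b * b - b * b) + 0 * (b * b) = 0);
    last by ring.
  apply: cvgD.
    apply: cvgD; first by apply: cvgM => //; exact: cvg_cst.
    apply: cvgM; first exact: cvg_cst.
    by apply: cvgB; [exact: cvgM | exact: cvg_cst].
  apply: cvgM; last exact: cvgM.
  exact: (cvg_comp _ _ s0 q0).
move=> t; have -> : g t = a + s t by rewrite rE /s /u; ring.
by rewrite qE /s /u; ring.
Qed.

Lemma jet2_max g a b c : jet2 g a b c ->
  (\forall t \near (0 : R), g t <= a) -> b = 0 /\ c <= 0.
Proof.
case=> r r0 rE /nbhs_norm0P[d d0 dP].
have nr e : 0 < e -> exists2 d', 0 < d' & forall t, `|t| < d' -> `|r t| < e.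
  move=> e0; move/cvgrPdist_lt : r0 => /(_ e e0) /nbhs_norm0P[d' d'0 H].
  by exists d' => // t /H /=; rewrite sub0r normrN.
have b0 : b = 0.
  apply/eqP/negP => /negP bN0.
  have [d1 d10 d1P] := nr 1 ltr01.
  have B0 : 0 < `|b| / (`|c| + 1 + 1).
    by rewrite divr_gt0 ?normr_gt0// ltr_wpDl// ltr_wpDl.
  pose m := Num.min (Num.min d d1) (`|b| / (`|c| + 1 + 1)) / 2.
  have m0 : 0 < m by rewrite /m divr_gt0// !lt_min d0 d10.
  have mm : m < Num.min (Num.min d d1) (`|b| / (`|c| + 1 + 1)).
    by rewrite /m ltr_pdivrMr// ltr_pMr ?ltr1n// !lt_min d0 d10.
  move: mm; rewrite !lt_min => /andP[/andP[md md1] mb].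
  pose t := Num.sg b * m.
  have tm : `|t| = m by rewrite /t normrM normr_sg bN0 mul1r gtr0_norm.
  have := dP t; rewrite /= tm => /(_ md); rewrite rE.
  have := d1P t; rewrite tm => /(_ md1) r1.
  have -> : b * t = `|b| * m by rewrite /t mulrA [b * _]mulrC -normrEsg.
  have -> : t ^+ 2 = m ^+ 2 by rewrite -(real_normK (num_real t)) tm.
  move: mb; rewrite ltr_pdivlMr; last by rewrite ltr_wpDl// ltr_wpDl.
  move=> mb.
  have : - `|c| <= c by rewrite lerNl ler_normr lexx orbT.
  move: r1; rewrite ltr_norml => /andP[r1 _] c1 H.
  have : 0 <= m * (c + r t + (`|c| + 1)) by apply: mulr_ge0; lra.
  have : 0 < m * (`|b| - m * (`|c| + 1 + 1)) by apply: mulr_gt0 => //; rewrite subr_gt0.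
  by nra.
split=> //; rewrite leNgt; apply/negP => c0.
have [d1 d10 d1P] := nr c c0.
pose m := Num.min d d1 / 2.
have m0 : 0 < m by rewrite /m divr_gt0// !lt_min d0 d10.
have mm : m < Num.min d d1.
  by rewrite /m ltr_pdivrMr// ltr_pMr ?ltr1n// !lt_min d0 d10.
move: mm; rewrite !lt_min => /andP[md md1].
have := dP m; rewrite /= gtr0_norm// => /(_ md); rewrite rE b0.
have := d1P m; rewrite gtr0_norm// => /(_ md1); rewrite ltr_norml => /andP[r1 _].
have : 0 < (c + r m) * m ^+ 2 by rewrite mulr_gt0 ?exprn_gt0//; lra.
by lra.
Qed.

(** Taylor-Young: [dg] is differentiable at 0 only, but the remainder [k] has derivative o(s), and
    the mean value theorem turns this into k(t) = o(t^2). *)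
Lemma jet2_peano g (dg : R -> R) c :
  (\forall t \near (0 : R), is_derive t (1 : R) g (dg t)) ->
  is_derive (0 : R) (1 : R) dg c -> jet2 g (g 0) (dg 0) (c / 2).
Proof.
move=> /nbhs_norm0P[d d0 dP] [ex dv].
pose r t := if t == 0 then 0 else (g t - g 0 - dg 0 * t) / t ^+ 2 - c / 2.
exists r; last first.
  move=> t; rewrite /r; case: eqVneq => [->|t0]; first by ring.
  by field.
apply/cvgrPdist_le => e e0.
have : h^-1 *: (dg h - dg 0) @[h --> 0^'] --> c.
  move: ex; rewrite /derivable.
  move=> /cvg_ex[l hl].
  have := hl => /cvg_lim; move: dv; rewrite /derive => -> // ce.
  move: hl; rewrite -ce//.
  under [X in X @ _ --> _ -> _]funext => h do rewrite /= addr0 [h%:A]mulr1.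
  by [].
move=> /cvgrPdist_le/(_ e e0)/nbhs_norm0P[d1 d10 d1P].
have dd : 0 < Num.min d d1 by rewrite lt_min d0 d10.
refine (near0I dd _) => t; rewrite lt_min => /andP[td td1].
rewrite sub0r normrN /r; case: eqVneq => [_|t0]; first by rewrite normr0 ltW.
pose k s := g s - g 0 - dg 0 * s - c / 2 * s ^+ 2.
have dk s : `|s| < d -> is_derive s (1 : R) k (dg s - dg 0 - c * s).
  move=> /dP ? ; rewrite /k; apply: is_derive_eq.
  by rewrite /GRing.scale /=; field.
have bk s : `|s| < d1 -> `|dg s - dg 0 - c * s| <= e * `|s|.
  move=> sd; have [->|s0] := eqVneq s 0; first by rewrite mulr0 !subrr normr0 mulr0.
  have := d1P s sd s0; rewrite /= distrC /GRing.scale /= => H.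
  have -> : dg s - dg 0 - c * s = (s^-1 * (dg s - dg 0) - c) * s by field.
  by rewrite normrM ler_wpM2r.
have k0 : k 0 = 0 by rewrite /k; ring.
have kt : `|k t| <= e * `|t| ^+ 2.
  have main s : `|s| <= `|t| -> `|(dg s - dg 0 - c * s) * t| <= e * `|t| ^+ 2.
    move=> st; rewrite normrM expr2 mulrA ler_wpM2r//.
    by apply: le_trans (bk _ (le_lt_trans st td1)) _; rewrite ler_wpM2l// ltW.
  have [tp|tn] := ltP 0 t.
    have [||s] := @MVT_segment R k (fun s => dg s - dg 0 - c * s) 0 t (ltW tp).
    - move=> s; rewrite in_itv /= => /andP[s0 st]; apply: dk.
      by rewrite gtr0_norm//; apply: lt_trans st _; rewrite -(gtr0_norm tp).
    - apply: derivable_within_continuous => s; rewrite in_itv /= => /andP[s0 st].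
      apply: (@ex_derive _ _ _ _ _ _ _ (dk s _)).
      by rewrite ger0_norm//; apply: le_lt_trans st _; rewrite -(gtr0_norm tp).
    rewrite in_itv /= k0 !subr0 => /andP[s0 st] ->; apply: main.
    by rewrite ger0_norm// gtr0_norm.
  have {tn t0}tn : t < 0 by rewrite lt_neqAle t0.
  have [||s] := @MVT_segment R k (fun s => dg s - dg 0 - c * s) t 0 (ltW tn).
  - move=> s; rewrite in_itv /= => /andP[s0 st]; apply: dk.
    by rewrite ltr0_norm//; apply: le_lt_trans td; rewrite ltr0_norm// lerN2 ltW.
  - apply: derivable_within_continuous => s; rewrite in_itv /= => /andP[s0 st].
    apply: (@ex_derive _ _ _ _ _ _ _ (dk s _)).
    by rewrite ler0_norm//; apply: le_lt_trans td; rewrite ltr0_norm// lerN2.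
  rewrite in_itv /= k0 !sub0r => /andP[s0 st] /eqP.
  rewrite mulrN eqr_opp => /eqP ->; apply: main.
  by rewrite ler0_norm// ltr0_norm// lerN2.
have -> : (g t - g 0 - dg 0 * t) / t ^+ 2 - c / 2 = k t / t ^+ 2.
  by rewrite /k; field.
rewrite normrM normfV normrX ler_pdivrMr// exprn_gt0// normr_gt0 //.
Qed.

Lemma is_derive_translate F a t b : is_derive (a + t) (1 : R) F b ->
  is_derive t (1 : R) (fun s => F (a + s)) b.
Proof.
move=> H; rewrite -[b]mulr1.
apply: (@is_derive1_comp R F (fun s => a + s) t b 1 H).
by apply: is_derive_eq; rewrite add0r mulr1.
Qed.

Lemma jet2_ln a : 0 < a ->
  jet2 (fun s => ln (a + s)) (ln a) a^-1 (- (2 * a ^+ 2)^-1).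
Proof.
move=> a0.
have H : jet2 (fun s => ln (a + s)) (ln (a + 0)) ((fun s => (a + s)^-1) 0)
    (- (a + 0) ^- 2 / 2).
  apply: (@jet2_peano _ (fun s => (a + s)^-1)).
    apply: (near0I a0) => t; rewrite ltr_norml => /andP[ta _].
    apply: is_derive_translate; apply: is_derive1_ln.
    by rewrite -ltrBlDl sub0r.
  apply: (@is_derive_translate (fun u => u^-1)).
  have ? : a + 0 != 0 by rewrite addr0 gt_eqF.
  rewrite -[X in is_derive _ _ _ X]mulr1.
  by apply: (@is_deriveV R id); rewrite //=; exact: is_derive_id.
apply: (jet2_ext H) => //; rewrite ?addr0//.
by field; rewrite gt_eqF.
Qed.

Lemma jet2_exp a :
  jet2 (fun s => expR (a + s)) (expR a) (expR a) (expR a / 2).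
Proof.
have D t : is_derive t (1 : R) (fun s => expR (a + s)) (expR (a + t)).
  exact: is_derive_translate.
have H : jet2 (fun s => expR (a + s)) (expR (a + 0)) ((fun s => expR (a + s)) 0)
    (expR (a + 0) / 2).
  by apply: (@jet2_peano _ (fun s => expR (a + s))) => //; exact: (near0I ltr01).
by apply: (jet2_ext H); rewrite ?addr0.
Qed.

Lemma jet2_lnE g a b c : 0 < a -> jet2 g a b c ->
  jet2 (fun t => ln (g t)) (ln a) (b / a) (c / a - b ^+ 2 / (2 * a ^+ 2)).
Proof.
move=> a0 H; apply: (jet2_ext (jet2_comp (jet2_ln a0) H)) => //.
  by rewrite mulrC.
by field; rewrite gt_eqF.
Qed.

Lemma jet2_expE g a b c : jet2 g a b c ->
  jet2 (fun t => expR (g t)) (expR a) (expR a * b) (expR a * (c + b ^+ 2 / 2)).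
Proof.
move=> H; apply: (jet2_ext (jet2_comp (jet2_exp a) H)) => //.
by field.
Qed.

Lemma jet2_sqr g a b c : jet2 g a b c ->
  jet2 (fun t => g t ^+ 2) (a ^+ 2) (2 * a * b) (2 * a * c + b ^+ 2).
Proof.
move=> H; have Q : jet2 (fun s => (a + s) ^+ 2) (a ^+ 2) (2 * a) 1.
  by apply: (jet2_ext (jet2_quad (a ^+ 2) (2 * a) 1)) => // t; ring.
apply: (jet2_ext (jet2_comp (F := fun x => x ^+ 2) Q H)) => //.
by rewrite mul1r.
Qed.

End Jets.

(** * Euclidean geometry and the normalized operator *)

Section Dot.
Context {R : realType} {n : nat}.
Local Notation V := 'rV[R]_n.
Implicit Types (x y z u : V) (S : 'M[R]_n).

Definition dot x y : R := \sum_(i < n) x 0 i * y 0 i.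

Lemma dotC x y : dot x y = dot y x.
Proof. by apply: eq_bigr => i _; rewrite mulrC. Qed.

Lemma dotDl x y z : dot (x + y) z = dot x z + dot y z.
Proof. by rewrite -big_split; apply: eq_bigr => i _; rewrite mxE mulrDl. Qed.

Lemma dotZl k x z : dot (k *: x) z = k * dot x z.
Proof. by rewrite mulr_sumr; apply: eq_bigr => i _; rewrite mxE mulrA. Qed.

Lemma dotDr x y z : dot x (y + z) = dot x y + dot x z.
Proof. by rewrite dotC dotDl !(dotC x). Qed.

Lemma dotZr k x z : dot x (k *: z) = k * dot x z.
Proof. by rewrite dotC dotZl dotC. Qed.

Lemma dotNl x z : dot (- x) z = - dot x z.
Proof. by rewrite -scaleN1r dotZl mulN1r. Qed.

Lemma dotNr x z : dot x (- z) = - dot x z.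
Proof. by rewrite dotC dotNl dotC. Qed.

Lemma dot0l x : dot 0 x = 0.
Proof. by rewrite -[0](scale0r x) dotZl mul0r. Qed.

Definition dotE := (dotDl, dotDr, dotZl, dotZr, dotNl, dotNr).

Lemma dot_ge0 x : 0 <= dot x x.
Proof. by apply: sumr_ge0 => i _; rewrite -expr2 sqr_ge0. Qed.

Lemma dot_eq0 x : (dot x x == 0) = (x == 0).
Proof.
apply/eqP/eqP => [/eqP|->]; last by rewrite dot0l.
rewrite psumr_eq0 => [/allP H|i _]; last by rewrite -expr2 sqr_ge0.
apply/rowP => i; rewrite mxE; apply/eqP.
by have := H i; rewrite mem_index_enum => /(_ isT); rewrite mulf_eq0 orbb.
Qed.

Lemma dot_gt0 x : (0 < dot x x) = (x != 0).
Proof. by rewrite lt_neqAle dot_ge0 andbT eq_sym dot_eq0. Qed.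

Lemma dot_delta x i : dot x (delta_mx 0 i) = x 0 i.
Proof.
rewrite /dot (bigD1 i)//= mxE !eqxx mulr1 big1 ?addr0// => j ji.
by rewrite mxE (negbTE ji) andbF mulr0.
Qed.

Lemma dot_sum_delta x y : \sum_(i < n) dot x (delta_mx 0 i) * dot y (delta_mx 0 i) = dot x y.
Proof. by apply: eq_bigr => i _; rewrite !dot_delta. Qed.

Lemma dot_delta_delta (i : 'I_n) : dot (delta_mx 0 i) (delta_mx 0 i) = 1.
Proof. by rewrite dot_delta mxE !eqxx. Qed.

Lemma sum_dot_delta_delta :
  \sum_(i < n) dot (delta_mx 0 i : V) (delta_mx 0 i) = n%:R.
Proof.
under eq_bigr do rewrite dot_delta_delta.
by rewrite sumr_const card_ord.
Qed.

Lemma dot_CS x y : dot x y ^+ 2 <= dot x x * dot y y.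
Proof.
have [->|x0] := eqVneq x 0; first by rewrite !dot0l mul0r expr0n.
have xp : 0 < dot x x by rewrite dot_gt0.
have := dot_ge0 (dot x x *: y - dot x y *: x).
rewrite !dotE (dotC y x) => H.
have : 0 <= dot x x * (dot x x * dot y y - dot x y ^+ 2) by apply: le_trans H _; nra.
by rewrite pmulr_rge0// subr_ge0.
Qed.

Lemma enormE x : enorm x = Num.sqrt (dot x x).
Proof. by congr Num.sqrt; apply: eq_bigr => i _; rewrite expr2. Qed.

Lemma sqr_enorm x : enorm x ^+ 2 = dot x x.
Proof. by rewrite enormE sqr_sqrtr// dot_ge0. Qed.

Lemma enorm_ge0 x : 0 <= enorm x.
Proof. by rewrite enormE sqrtr_ge0. Qed.

Lemma enorm_gt0 x : (0 < enorm x) = (x != 0).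
Proof. by rewrite enormE sqrtr_gt0 dot_gt0. Qed.

Lemma enorm0 : enorm (0 : V) = 0.
Proof. by rewrite enormE dot0l sqrtr0. Qed.

Lemma enormZ k x : enorm (k *: x) = `|k| * enorm x.
Proof. by rewrite !enormE !dotE mulrA -expr2 sqrtrM ?sqr_ge0// sqrtr_sqr. Qed.

Lemma enormN x : enorm (- x) = enorm x.
Proof. by rewrite -scaleN1r enormZ normrN1 mul1r. Qed.

Lemma enormB x y : enorm (x - y) = enorm (y - x).
Proof. by rewrite -enormN opprB. Qed.

Lemma dot_le_enorm x y : dot x y <= enorm x * enorm y.
Proof.
apply: le_trans (ler_norm _) _.
rewrite -sqrtr_sqr !enormE -sqrtrM ?dot_ge0// ler_wsqrtr//.
exact: dot_CS.
Qed.

Lemma ler_enormD x y : enorm (x + y) <= enorm x + enorm y.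
Proof.
rewrite -(@ler_pXn2r _ 2)// ?nnegrE ?addr_ge0 ?enorm_ge0//.
rewrite sqr_enorm !dotE sqrrD !sqr_enorm (dotC y x).
by have := dot_le_enorm x y; lra.
Qed.

Lemma ler_enormB x y : enorm (x - y) <= enorm x + enorm y.
Proof. by rewrite -[enorm y]enormN ler_enormD. Qed.

Lemma ler_enorm_dist x y z : enorm (x - z) <= enorm (x - y) + enorm (y - z).
Proof. by rewrite -(subrKA y) ler_enormD. Qed.

Definition qf S x : R := \sum_(i < n) \sum_(j < n) x 0 i * x 0 j * S i j.

Lemma qfZ S k x : qf S (k *: x) = k ^+ 2 * qf S x.
Proof.
rewrite mulr_sumr; apply: eq_bigr => i _; rewrite mulr_sumr.
by apply: eq_bigr => j _; rewrite !mxE; ring.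
Qed.

Lemma qf_scale S k x : qf (k *: S) x = k * qf S x.
Proof.
rewrite mulr_sumr; apply: eq_bigr => i _; rewrite mulr_sumr.
by apply: eq_bigr => j _; rewrite !mxE; ring.
Qed.

Lemma qf_delta S i : qf S (delta_mx 0 i) = S i i.
Proof.
rewrite /qf (bigD1 i)//= [X in _ + X]big1 => [|j ji]; last first.
  by rewrite big1// => k _; rewrite mxE (negbTE ji) andbF !mul0r.
rewrite addr0 (bigD1 i)//= big1 => [|j ji]; last first.
  by rewrite mxE (mxE _ _ 0 j) (negbTE ji) andbF mulr0 mul0r.
by rewrite mxE !eqxx !mul1r addr0.
Qed.

Lemma trace_qf S : \tr S = \sum_(i < n) qf S (delta_mx 0 i).
Proof. by apply: eq_bigr => i _; rewrite qf_delta. Qed.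

(* The vectors [e_i - 2 (z_i / |z|^2) z] form the reflected orthonormal basis. *)
Lemma trace_qf_reflect S z : z != 0 ->
  \tr S = \sum_(i < n) qf S (delta_mx 0 i - (2 * z 0 i / dot z z) *: z).
Proof.
rewrite -dot_gt0 => z0.
have E i : qf S (delta_mx 0 i - (2 * z 0 i / dot z z) *: z) =
    S i i - (2 / dot z z) * (\sum_(j < n) z 0 i * z 0 j * S i j)
     - (2 / dot z z) * (\sum_(j < n) z 0 i * z 0 j * S j i)
     + 4 / dot z z ^+ 2 * qf S z * (z 0 i * z 0 i).
  set k := 2 * z 0 i / dot z z.
  have D1 j k' : (delta_mx 0 i - k *: z) 0 j * (delta_mx 0 i - k *: z) 0 k' =
     ((delta_mx 0 i : V) 0 j * (delta_mx 0 i : V) 0 k') - k * ((delta_mx 0 i : V) 0 j * z 0 k')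
     - k * (z 0 j * (delta_mx 0 i : V) 0 k') + k ^+ 2 * (z 0 j * z 0 k').
    by rewrite !mxE; ring.
  have -> : qf S (delta_mx 0 i - k *: z) = qf S (delta_mx 0 i)
     - k * (\sum_(j < n) (\sum_(l < n) ((delta_mx 0 i : V) 0 j * z 0 l) * S j l))
     - k * (\sum_(j < n) (\sum_(l < n) (z 0 j * (delta_mx 0 i : V) 0 l) * S j l))
     + k ^+ 2 * qf S z.
    rewrite /qf !mulr_sumr -!sumrN -!big_split /=; apply: eq_bigr => j _.
    rewrite !mulr_sumr -!sumrN -!big_split /=; apply: eq_bigr => l _.
    by rewrite D1; ring.
  rewrite qf_delta.
  rewrite (bigD1 i)//= [X in _ - k * (_ + X)]big1 => [|j ji]; last first.
    by rewrite big1// => l _; rewrite mxE (negbTE ji) andbF !mul0r.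
  have -> : \sum_(j < n) \sum_(l < n) z 0 j * (delta_mx 0 i : V) 0 l * S j l =
     \sum_(j < n) z 0 j * S j i.
    apply: eq_bigr => j _; rewrite (bigD1 i)//= big1 => [|l li]; last first.
      by rewrite mxE (negbTE li) andbF mulr0 mul0r.
    by rewrite mxE !eqxx mulr1 addr0.
  have -> : \sum_(l < n) (delta_mx 0 i : V) 0 i * z 0 l * S i l =
     \sum_(l < n) z 0 l * S i l.
    by apply: eq_bigr => l _; rewrite mxE !eqxx mul1r.
  have -> : \sum_(j < n) z 0 i * z 0 j * S i j = z 0 i * \sum_(l < n) z 0 l * S i l.
    by rewrite mulr_sumr; apply: eq_bigr => l _; rewrite mulrA.
  have -> : \sum_(j < n) z 0 i * z 0 j * S j i = z 0 i * \sum_(l < n) z 0 l * S l i.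
    by rewrite mulr_sumr; apply: eq_bigr => l _; rewrite mulrA.
  by rewrite addr0 /k; field; rewrite gt_eqF.
under eq_bigr do rewrite E.
rewrite !big_split /= !sumrN -!mulr_sumr -/(qf S z) -/(dot z z).
have -> : \sum_(i < n) \sum_(j < n) z 0 i * z 0 j * S j i = qf S z.
  rewrite exchange_big; apply: eq_bigr => i _; apply: eq_bigr => j _.
  by rewrite [z 0 j * _]mulrC.
by rewrite /mxtrace; field; rewrite gt_eqF.
Qed.

End Dot.

Section Operator.
Context {R : realType} {n : nat}.
Local Notation V := 'rV[R]_n.
Implicit Types (x y z u p : V) (S : 'M[R]_n) (w : V -> R).

(* [p] and [S] are the gradient and Hessian of [w] at [x], as seen along lines. *)
Definition has_jet w x p S : Prop :=
  forall u, jet2 (fun t => w (x + t *: u)) (w x) (dot p u) (qf S u / 2).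

(* The normalized [n]-Laplacian [|p|^(2-n) div (|p|^(n-2) p)]. *)
Definition nop p S : R := \tr S + (n - 2)%:R * qf S p / dot p p.

Lemma derive_sum_partial (g : V -> R) y u : differentiable g y ->
  'D_u g y = \sum_(j < n) u 0 j * partial j g y.
Proof.
move=> dg; rewrite deriveE//.
rewrite {1}(row_sum_delta u) linear_sum; apply: eq_bigr => j _.
by rewrite linearZ /= -deriveE.
Qed.

Lemma is_derive_line (g : V -> R) x u t : derivable g (x + t *: u) u ->
  is_derive t (1 : R) (fun s => g (x + s *: u)) ('D_u g (x + t *: u)).
Proof.
have E : (fun h : R => h^-1 *: (((fun s => g (x + s *: u)) \o shift t) (h *: (1 : R)) -
      g (x + t *: u))) =
   (fun h => h^-1 *: ((g \o shift (x + t *: u)) (h *: u) - g (x + t *: u))).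
  apply/funext => h /=; congr (_ *: (g _ - _)).
  by rewrite [h *: 1]mulr1 scalerDl addrCA addrA.
by rewrite /derivable /derive -E => d; split.
Qed.

Lemma derive_line (g : V -> R) x u d :
  is_derive (0 : R) (1 : R) (fun s => g (x + s *: u)) d -> 'D_u g x = d.
Proof.
have E : (fun h : R => h^-1 *: (((fun s => g (x + s *: u)) \o shift 0) (h *: (1 : R)) -
      g (x + 0 *: u))) =
   (fun h => h^-1 *: ((g \o shift x) (h *: u) - g x)).
  by apply/funext => h /=; rewrite scale0r [h *: 1]mulr1 !addr0 [x + _]addrC.
by case=> _ <-; rewrite /derive -E.
Qed.

Definition hess w x : 'M[R]_n := \matrix_(i, j) partial j (partial i w) x.

Lemma near_line x u (U : set V) : open U -> U x ->
  \forall t \near (0 : R), U (x + t *: u).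
Proof.
move=> oU Ux.
have H : (fun t : R => x + t *: u) t @[t --> (0 : R)] --> x.
  rewrite -[X in _ --> X]addr0; apply: cvgD; first exact: cvg_cst.
  by rewrite -(scale0r u); apply: cvgZr_tmp; exact: cvg_id.
by apply: H; exact: open_nbhs_nbhs.
Qed.

Lemma C2_has_jet (U : set V) w x : open U -> C2_on U w -> U x ->
  has_jet w x (grad w x) (hess w x).
Proof.
move=> oU Cw Ux u.
pose dg (t : R) := \sum_(i < n) u 0 i * partial i w (x + t *: u).
have H : jet2 (fun t => w (x + t *: u)) (w (x + 0 *: u)) (dg 0)
    ((\sum_(i < n) u 0 i * (\sum_(j < n) u 0 j * partial j (partial i w) x)) / 2).
  apply: (@jet2_peano _ _ dg).
    apply: filterS (near_line u oU Ux) => t /Cw[dw _].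
    rewrite /dg -derive_sum_partial//.
    apply: is_derive_line; exact: diff_derivable.
  have [_ [d2 _]] := Cw x Ux.
  have -> : dg = \sum_(i < n) (fun t => u 0 i * partial i w (x + t *: u)).
    by apply/funext => t; rewrite fct_sumE.
  apply: is_derive_sum => i.
  rewrite -derive_sum_partial//.
  have D : is_derive (0 : R) (1 : R) (fun t => partial i w (x + t *: u))
      ('D_u (partial i w) (x + 0 *: u)).
    by apply: is_derive_line; rewrite scale0r addr0; exact: diff_derivable.
  rewrite scale0r addr0 in D.
  by apply: is_derive_eq.
apply: (jet2_ext H) => //.
- by rewrite scale0r addr0.
- by apply: eq_bigr => i _; rewrite scale0r addr0 mxE mulrC.
- congr (_ / 2); apply: eq_bigr => i _; rewrite mulr_sumr.
  by apply: eq_bigr => j _; rewrite mxE mulrA.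
Qed.

Lemma nlap_nop (U : set V) w x : open U -> C2_on U w -> U x -> grad w x != 0 ->
  nlap w x = enorm (grad w x) ^+ (n - 2) * nop (grad w x) (hess w x).
Proof.
move=> oU Cw Ux p0.
have [_ [d2 _]] := Cw x Ux.
set p := grad w x; set S := hess w x; set k := (n - 2)%N.
have pp : 0 < dot p p by rewrite dot_gt0.
have E0 : 0 < enorm p by rewrite enorm_gt0.
have P i : partial i (nflux w i) x = enorm p ^+ k *
   (S i i + k%:R * (\sum_(j < n) p 0 i * p 0 j * S j i) / dot p p).
  pose pj j (t : R) := partial j w (x + t *: ebasis i).
  have pj0 j : pj j 0 = p 0 j by rewrite /pj scale0r addr0 mxE.
  have D j : is_derive (0 : R) (1 : R) (pj j) (S j i).
    rewrite mxE; have := @is_derive_line (partial j w) x (ebasis i) 0.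
    by rewrite scale0r addr0; apply; exact: diff_derivable.
  pose G := \sum_(j < n) pj j ^+ 2.
  have G0 : G 0 = dot p p.
    rewrite /G fct_sumE; apply: eq_bigr => j _.
    by rewrite fctE pj0 expr2.
  have DG : is_derive (0 : R) (1 : R) G (\sum_(j < n) 2 * p 0 j * S j i).
    apply: is_derive_sum => j.
    by apply: is_derive_eq; rewrite pj0 /= expr1.
  have DS : is_derive (0 : R) (1 : R) (Num.sqrt \o G)
      ((2 * enorm p)^-1 * (\sum_(j < n) 2 * p 0 j * S j i)).
    apply: is_derive1_comp => //.
    by rewrite enormE -G0; apply: is_derive1_sqrt; rewrite G0.
  have DP : is_derive (0 : R) (1 : R) ((Num.sqrt \o G) ^+ k * pj i)
      (enorm p ^+ k * S i i + p 0 i * (k%:R * enorm p ^+ k.-1 *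
      ((2 * enorm p)^-1 * (\sum_(j < n) 2 * p 0 j * S j i)))).
    apply: is_derive_eq.
    by rewrite !fctE /= pj0 G0 -enormE /GRing.scale /=.
  have -> : partial i (nflux w i) x = (enorm p ^+ k * S i i + p 0 i * (k%:R * enorm p ^+ k.-1 *
      ((2 * enorm p)^-1 * (\sum_(j < n) 2 * p 0 j * S j i)))).
    apply: derive_line; move: DP; congr (is_derive _ _ _ _).
    apply/funext => t; rewrite /nflux !fctE /=; congr (_ ^+ _ * _).
    congr Num.sqrt; rewrite /G fct_sumE; apply: eq_bigr => j _.
    by rewrite mxE fctE.
  have -> : \sum_(j < n) 2 * p 0 j * S j i = 2 * \sum_(j < n) p 0 j * S j i.
    by rewrite mulr_sumr; apply: eq_bigr => j _; rewrite mulrA.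
  have -> : \sum_(j < n) p 0 i * p 0 j * S j i = p 0 i * \sum_(j < n) p 0 j * S j i.
    by rewrite mulr_sumr; apply: eq_bigr => j _; rewrite mulrA.
  rewrite -sqr_enorm.
  (* The truncated exponent [k.-1] is wrong for n = 2, but there the whole term carries the factor
     0. *)
  case: k {DP} => [|k]; first by rewrite mulr0n !mul0r mulr0 !addr0.
  by rewrite exprS /=; field; rewrite gt_eqF.
rewrite /nlap; under eq_bigr do rewrite P.
rewrite -mulr_sumr big_split /=; congr (_ * (_ + _)).
rewrite -mulr_suml -mulr_sumr; congr (_ * _ / _).
rewrite /qf exchange_big; apply: eq_bigr => i _; apply: eq_bigr => j _.
by rewrite [p 0 j * _]mulrC.
Qed.

End Operator.

(** * Comparison principle *)

Lemma compact_min (R : realType) (T : topologicalType) (A : set T) (f : T -> R) :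
  A !=set0 -> compact A -> (forall x, A x -> {for x, continuous f}) ->
  exists2 x, A x & forall y, A y -> f x <= f y.
Proof.
move=> A0 cA fA; have [|x xA xm] := @compact_EVT_min _ _ f A A0 cA.
  by apply: continuous_in_subspaceT => x /set_mem/fA.
by exists x => [|y Ay]; [exact: set_mem|exact/xm/mem_set].
Qed.

Section Topology.
Context {R : realType} {n : nat}.
Local Notation V := 'rV[R]_n.
Implicit Types (x y c : V) (A : set V).

Lemma coordB_continuous c i : continuous (fun x : V => (x - c) 0 i).
Proof.
have -> : (fun x : V => (x - c) 0 i) = (fun x : V => x 0 i - c 0 i).
  by apply/funext => y; rewrite !mxE.
move=> x; apply: continuousB; last exact: cst_continuous.
exact: (@coord_continuous R 1 n 0 i x).
Qed.

Lemma dot_continuous c : continuous (fun x : V => dot (x - c) (x - c)).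
Proof.
apply: continuous_big => [|i _ x]; first exact: add_continuous.
by apply: continuousM; exact: coordB_continuous.
Qed.

Lemma enormB_continuous c : continuous (fun x : V => enorm (x - c)).
Proof.
have -> : (fun x : V => enorm (x - c)) = Num.sqrt \o (fun x : V => dot (x - c) (x - c)).
  by apply/funext => y /=; rewrite enormE.
move=> x; apply: continuous_comp; first exact: dot_continuous.
exact: sqrt_continuous.
Qed.

Lemma enorm_continuous : continuous (@enorm R n).
Proof.
have -> : @enorm R n = (fun x => enorm (x - 0)) by apply/funext => x; rewrite subr0.
exact: enormB_continuous.
Qed.

Lemma normr_le_enorm x : `|x| <= enorm x.
Proof.
have -> : `|x| = mx_norm x by [].
rewrite mx_normrE; apply: bigmax_le => [|[i j] _ /=]; first exact: enorm_ge0.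
rewrite ord1 enormE -sqrtr_sqr ler_wsqrtr// /dot (bigD1 j)//= -expr2 lerDl.
by apply: sumr_ge0 => k _; rewrite -expr2 sqr_ge0.
Qed.

Lemma compact_enorm A c r : closed A -> (forall x, A x -> enorm (x - c) <= r) -> compact A.
Proof.
move=> cA Ar; apply: bounded_closed_compact => //.
exists (r + enorm c); split=> [|M rM x Ax]; first exact: num_real.
apply: le_trans (normr_le_enorm _) _; apply/ltW/le_lt_trans/rM.
rewrite -[x](subrK c); apply: le_trans (ler_enormD _ _) _.
by rewrite lerD2r Ar.
Qed.

Lemma closed_enorm_le c r : closed [set x : V | enorm (x - c) <= r].
Proof.
by apply: (closed_comp (f := fun x : V => enorm (x - c)) (D := [set t | t <= r]));
  [move=> x _; exact: enormB_continuous|exact: closed_le].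
Qed.

Lemma closed_enorm_ge c r : closed [set x : V | r <= enorm (x - c)].
Proof.
by apply: (closed_comp (f := fun x : V => enorm (x - c)) (D := [set t | r <= t]));
  [move=> x _; exact: enormB_continuous|exact: closed_ge].
Qed.

Lemma open_enorm_lt c r : open [set x : V | enorm (x - c) < r].
Proof.
by apply: (open_comp (f := fun x : V => enorm (x - c)) (D := [set t | t < r]));
  [move=> x _; exact: enormB_continuous|exact: open_lt].
Qed.

Lemma open_enorm_gt c r : open [set x : V | r < enorm (x - c)].
Proof.
by apply: (open_comp (f := fun x : V => enorm (x - c)) (D := [set t | r < t]));
  [move=> x _; exact: enormB_continuous|exact: open_gt].
Qed.

Lemma open_pball r : open (@pball R n r).
Proof.
have -> : @pball R n r = [set x | 0 < enorm (x - 0)] `&` [set x | enorm (x - 0) < r].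
  by apply/seteqP; split=> x /=; rewrite subr0 => /andP.
by apply: openI; [exact: open_enorm_gt|exact: open_enorm_lt].
Qed.

End Topology.

Section Comparison.
Context {R : realType} {n : nat}.
Local Notation V := 'rV[R]_n.
Implicit Types (x y c : V) (w H : V -> R).

Definition supersol w x : Prop :=
  exists p S, has_jet w x p S /\ (p != 0 -> nop p S <= 0).

(** [b] is half the Hessian form of [H], so the last condition says that half the normalized
    operator is positive. A nonzero gradient is required because [supersol] is silent at critical
    points. *)
Definition strict_subsol H x : Prop :=
  exists (q : V) (b : V -> R), [/\ q != 0,
    forall u, jet2 (fun t => H (x + t *: u)) (H x) (dot q u) (b u) &
    0 < \sum_(i < n) b (delta_mx 0 i) + (n - 2)%:R * b q / dot q q].

(** At a minimum of w - H the gradients agree and the Hessian forms are ordered in every direction,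
    in particular along the basis and along [q], which are the directions the operator sees. *)
Lemma no_touch w H x : supersol w x -> strict_subsol H x ->
  (forall u, \forall t \near (0 : R), w x - H x <= w (x + t *: u) - H (x + t *: u)) ->
  False.
Proof.
move=> [p [S [wp wS]]] [q [b [q0 Hq Hb]]] m.
have T u : dot q u - dot p u = 0 /\ b u - qf S u / 2 <= 0.
  have J := jet2D (Hq u) (jet2N (wp u)).
  apply: (jet2_max J); apply: filterS (m u) => t; lra.
(* Testing the first-order condition along [q] and along [p] gives |q - p|^2 = 0. *)
have pq : p = q.
  apply/eqP; rewrite eq_sym -subr_eq0 -dot_eq0 dotDr dotNr.
  by have [+ _] := T q; have [+ _] := T p; rewrite !dotE; lra.
move: wS; rewrite pq => /(_ q0); rewrite /nop trace_qf.
have qq : 0 < dot q q by rewrite dot_gt0.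
have : \sum_(i < n) b (delta_mx 0 i) <= (\sum_(i < n) qf S (delta_mx 0 i)) / 2.
  rewrite mulr_suml; apply: ler_sum => i _.
  by have [_] := T (delta_mx 0 i); rewrite subr_le0.
have : (n - 2)%:R * b q / dot q q <= (n - 2)%:R * qf S q / dot q q / 2.
  rewrite -[leRHS]mulrA [_^-1 * 2^-1]mulrC mulrA ler_pM2r ?invr_gt0//.
  rewrite -mulrA ler_wpM2l// ?ler0n//.
  by have [_] := T q; rewrite subr_le0.
move: Hb; lra.
Qed.

(** The minimum of w - H over [K] cannot lie in [U] if it is negative; the points of [K] outside [U]
    act as the boundary. *)
Lemma comparison (K U : set V) w H : compact K -> open U -> U `<=` K ->
  (forall x, K x -> {for x, continuous w}) -> (forall x, K x -> {for x, continuous H}) ->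
  (forall x, K x -> ~ U x -> H x <= w x) ->
  (forall x, U x -> supersol w x) -> (forall x, U x -> strict_subsol H x) ->
  forall x, K x -> H x <= w x.
Proof.
move=> cK oU UK cw cH bd ws Hs x0 Kx0.
have [||x Kx xm] := @compact_min R V K (fun x => w x - H x) _ cK.
- by exists x0.
- by move=> x Kx; apply: continuousB; [exact: cw|exact: cH].
suff : H x <= w x by have := xm _ Kx0; lra.
have [Ux|/bd] := pselect (U x); last exact.
exfalso; apply: (no_touch (ws x Ux) (Hs x Ux)) => u.
by apply: filterS (near_line u oU Ux) => t /UK /xm.
Qed.

Lemma jet2_dot c x u :
  jet2 (fun t => dot (x + t *: u - c) (x + t *: u - c)) (dot (x - c) (x - c))
     (2 * dot (x - c) u) (dot u u).
Proof.
apply: (jet2_ext (jet2_quad _ _ _)) => // t.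
rewrite [x + _ - c]addrAC.
by rewrite (dotDl (x - c)) !(dotDr _ (x - c)) !dotZl !dotZr (dotC u (x - c)); ring.
Qed.

Lemma jet2_ln_dot c x u : x != c ->
  jet2 (fun t => ln (dot (x + t *: u - c) (x + t *: u - c))) (ln (dot (x - c) (x - c)))
   (2 * dot (x - c) u / dot (x - c) (x - c))
   (dot u u / dot (x - c) (x - c) - 2 * dot (x - c) u ^+ 2 / dot (x - c) (x - c) ^+ 2).
Proof.
move=> xc; have D0 : 0 < dot (x - c) (x - c) by rewrite dot_gt0 subr_eq0.
apply: (jet2_ext (jet2_lnE D0 (jet2_dot c x u))) => //.
by field; rewrite gt_eqF.
Qed.

(** The logarithm is n-harmonic, and the gradient of the sum is radial, so half the operator is
    exactly e (2 n - 2), whatever [a]. The condition on [a] says that the radial gradient does not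
    vanish. *)
Lemma radial_strict_subsol c x a b e : (2 <= n)%N -> x != c -> 0 < e ->
  a != 2 * e * dot (x - c) (x - c) ->
  strict_subsol (fun y => - (a / 2) * ln (dot (y - c) (y - c)) + b
     + e * dot (y - c) (y - c)) x.
Proof.
move=> n2 xc e0 ae; set z := x - c; set D := dot z z.
have D0 : 0 < D by rewrite dot_gt0 subr_eq0.
pose k := 2 * e - a / D.
have k0 : k != 0.
  apply: contra_neq ae => k0; apply/eqP; rewrite eq_sym -subr_eq0.
  have -> : 2 * e * D - a = k * D by rewrite /k; field; rewrite gt_eqF.
  by rewrite k0 mul0r.
pose bb u := - (a / 2) * (dot u u / D - 2 * dot z u ^+ 2 / D ^+ 2) + e * dot u u.
exists (k *: z), bb; split.
- by rewrite scaler_eq0 negb_or k0 subr_eq0.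
- move=> u.
  have J := jet2D (jet2D (jet2Z (- (a / 2)) (jet2_ln_dot u xc)) (jet2_cst b))
     (jet2Z e (jet2_dot c x u)).
  apply: (jet2_ext J) => //; rewrite -/z -/D.
    by rewrite dotZl /k; field; rewrite gt_eqF.
  by rewrite /bb addr0.
have -> : \sum_(i < n) bb (delta_mx 0 i) = - (a / 2) * (n%:R / D - 2 / D) + e * n%:R.
  rewrite big_split /= -!mulr_sumr big_split /= sumrN -!mulr_suml -mulr_sumr.
  rewrite sum_dot_delta_delta.
  have -> : \sum_(i < n) dot z (delta_mx 0 i) ^+ 2 = D.
    by rewrite /D -dot_sum_delta; apply: eq_bigr => i _; rewrite expr2.
  by field; rewrite gt_eqF.
have -> : bb (k *: z) = k ^+ 2 * D * (a / 2 / D + e).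
  by rewrite /bb !dotZr !dotZl -/D; field; rewrite gt_eqF.
have -> : dot (k *: z) (k *: z) = k ^+ 2 * D by rewrite dotZl dotZr -/D; ring.
rewrite natrB//.
have -> : - (a / 2) * (n%:R / D - 2 / D) + e * n%:R
   + (n%:R - 2) * (k ^+ 2 * D * (a / 2 / D + e)) / (k ^+ 2 * D) = e * (2 * n%:R - 2).
  by field; rewrite k0 gt_eqF.
apply: mulr_gt0 => //.
have : (2 : R) <= n%:R by rewrite ler_nat.
by lra.
Qed.

Lemma ln_enorm x : x != 0 -> ln (enorm x) = ln (dot x x) / 2.
Proof.
move=> x0; rewrite -sqr_enorm lnXn ?enorm_gt0// -[_ *+ 2]mulr_natr.
by rewrite mulfK.
Qed.

Lemma ln_dot_continuous c x : x != c -> {for x, continuous (fun y => ln (dot (y - c) (y - c)))}.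
Proof.
move=> xc; apply: (continuous_comp (f := fun y : V => dot (y - c) (y - c))).
  exact: dot_continuous.
by apply: continuous_ln; rewrite dot_gt0 subr_eq0.
Qed.

Lemma comparison_log (K U : set V) w c a b s r : (2 <= n)%N -> 0 < s ->
  compact K -> open U -> U `<=` K ->
  (forall x, K x -> s <= enorm (x - c) <= r) ->
  (forall x, K x -> {for x, continuous w}) -> (forall x, U x -> supersol w x) ->
  (forall x, K x -> ~ U x -> b - a * ln (enorm (x - c)) <= w x) ->
  forall x, K x -> b - a * ln (enorm (x - c)) <= w x.
Proof.
move=> n2 s0 cK oU UK Ksr cw ws bd x0 Kx0.
have xc x : K x -> x != c.
  move=> /Ksr/andP[sx _]; rewrite -subr_eq0 -enorm_gt0; exact: lt_le_trans sx.
have r0 : 0 < r by have /andP[h1 h2] := Ksr _ Kx0; apply: lt_le_trans s0 (le_trans h1 h2).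
apply/ler_addgt0Pl => e e0.
(* The perturbation d |x - c|^2 costs at most [e]. For a > 0 its radial derivative is at most half
   that of the logarithm; for a <= 0 the two derivatives have no opposite signs, so no critical
   point arises. *)
pose d := Num.min e (if 0 < a then a / 4 else 1) / r ^+ 2.
have d0 : 0 < d.
  rewrite divr_gt0 ?exprn_gt0// lt_min e0 /=; case: ifP => // a0.
  by rewrite divr_gt0.
have ed : d * r ^+ 2 <= e.
  by rewrite /d divfK ?gt_eqF ?exprn_gt0// ge_min lexx.
have ad x : K x -> a != 2 * d * dot (x - c) (x - c).
  move=> Kx; have D0 : 0 < dot (x - c) (x - c) by rewrite dot_gt0 subr_eq0 xc.
  have Dr : dot (x - c) (x - c) <= r ^+ 2.
    by rewrite -sqr_enorm ler_pXn2r ?nnegrE ?enorm_ge0 ?(ltW r0)//; case/andP: (Ksr _ Kx).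
  have dD : d * dot (x - c) (x - c) <= d * r ^+ 2 by rewrite ler_pM2l.
  have [a0|a0] := ltP 0 a; last first.
    apply/negbT/lt_eqF/(le_lt_trans a0).
    by rewrite -mulrA mulr_gt0// mulr_gt0.
  have dra : d * r ^+ 2 <= a / 4.
    by rewrite /d a0 divfK ?gt_eqF ?exprn_gt0// ge_min lexx orbT.
  rewrite gt_eqF//; lra.
have H : forall x, K x -> - (a / 2) * ln (dot (x - c) (x - c)) + (b - d * r ^+ 2)
    + d * dot (x - c) (x - c) <= w x.
  apply: (@comparison K U) => //.
  - move=> x Kx; apply: continuousD; last first.
      by apply: continuousM; [exact: cst_continuous|exact: dot_continuous].
    apply: continuousD; last exact: cst_continuous.
    by apply: continuousM; [exact: cst_continuous|apply: ln_dot_continuous; exact: xc].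
  - move=> x Kx nUx; apply: le_trans (bd x Kx nUx).
    rewrite ln_enorm ?subr_eq0 ?xc//.
    have : d * dot (x - c) (x - c) <= d * r ^+ 2.
      rewrite ler_pM2l// -sqr_enorm ler_pXn2r ?nnegrE ?enorm_ge0 ?(ltW r0)//.
      by case/andP: (Ksr _ Kx).
    lra.
  - by move=> x /UK Kx; apply: radial_strict_subsol => //; [exact: xc|exact: ad].
have := H _ Kx0; rewrite ln_enorm ?subr_eq0 ?xc//.
have : 0 <= d * dot (x0 - c) (x0 - c) by rewrite mulr_ge0 ?dot_ge0// ltW.
by lra.
Qed.

End Comparison.

(** * Two-point Hoelder estimate *)

Section Holder.
Context {R : realType} {n : nat}.
Local Notation V := 'rV[R]_n.
Implicit Types (x y z p q v : V) (u : V -> R).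

(** The left side is 2 |p| |q| - 2 <p, q>, which falls short of |p - q|^2 by (|p| - |q|)^2. *)
Lemma dist_unit_le p q e : p != 0 -> q != 0 ->
  e = (enorm p)^-1 *: p - (enorm q)^-1 *: q ->
  dot e e * (enorm p * enorm q) <= dot (p - q) (p - q).
Proof.
move=> p0 q0 ->; rewrite !dotE -!sqr_enorm (dotC q p).
have a0 : 0 < enorm p by rewrite enorm_gt0.
have b0 : 0 < enorm q by rewrite enorm_gt0.
set a := enorm p in a0 *; set b := enorm q in b0 *.
rewrite [leLHS](_ : _ = 2 * a * b - 2 * dot p q); last by field; rewrite !gt_eqF.
by have : 0 <= (a - b) ^+ 2 by [exact: sqr_ge0]; lra.
Qed.

Lemma dot_sqrt_enorm z : dot z z = Num.sqrt (enorm z) ^+ 4.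
Proof. by rewrite -sqr_enorm -{1}(sqr_sqrtr (enorm_ge0 z)) -exprM. Qed.

(** In this form the jet of |z|^(1/2) follows from those of the exponential and the logarithm. *)
Lemma sqrt_enorm_exp z : z != 0 -> Num.sqrt (enorm z) = expR (ln (dot z z) / 4).
Proof.
rewrite -enorm_gt0 -sqrtr_gt0 dot_sqrt_enorm; set E := Num.sqrt _ => E0.
by rewrite lnXn// -[ln E *+ 4]mulr_natr mulfK// lnK.
Qed.

Lemma jet2_sqrt_enorm z v : z != 0 -> let E := Num.sqrt (enorm z) in
  jet2 (fun t => expR (ln (dot (z + t *: v) (z + t *: v)) / 4)) E
    (E * dot z v / (2 * E ^+ 4))
    (E * (dot v v / (4 * E ^+ 4) - 3 / 8 * dot z v ^+ 2 / E ^+ 8)).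
Proof.
move=> z0 E.
have E0 : 0 < E by rewrite sqrtr_gt0 enorm_gt0.
have DE : dot z z = E ^+ 4 by rewrite dot_sqrt_enorm.
have J0 := jet2_ln_dot v z0; rewrite subr0 DE in J0.
have J1 := jet2_expE (jet2Z 4^-1 J0).
have EE : expR (4^-1 * ln (E ^+ 4)) = E.
  by rewrite mulrC -DE -sqrt_enorm_exp.
rewrite EE in J1.
apply: (jet2_ext J1) => //.
- by move=> t; rewrite subr0 mulrC.
- by field; rewrite gt_eqF.
- by field; rewrite gt_eqF.
Qed.

(** As E < 1/2, every positive term is at most a multiple of E^(-3), with total coefficient M0 + 16
    N + 272 (N - 2); this is less than [L], hence the 300 there. *)
Lemma holder_constant_absurd (N M0 L E : R) : 2 <= N -> 0 <= M0 -> 0 < E ->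
  E < 1 / 2 -> L = 16 + M0 + 300 * N ->
  - M0 <= - (L / E ^+ 3) + 16 * N + (N - 2) * (256 / (L * E) + 16) -> False.
Proof.
move=> N2 M00 E0 E12 LE.
have L16 : 16 <= L by lra.
have E3 : 1 <= (E ^+ 3)^-1.
  rewrite invf_ge1 ?exprn_gt0//; apply: exprn_ile1; first exact: ltW.
  by lra.
have X : 256 / (L * E) <= 256 * (E ^+ 3)^-1.
  apply: ler_wpM2l; first by lra.
  have LE0 : 0 < L * E by apply: mulr_gt0 => //; lra.
  have : E ^+ 2 * E <= L * E by apply: ler_wpM2r; [exact: ltW|nra].
  by rewrite -exprSr lef_pV2// posrE exprn_gt0.
move: E3 X; set t := (E ^+ 3)^-1; set x := 256 / (L * E) => E3 X main.
have : (N - 2) * (x + 16) <= (N - 2) * (272 * t) by apply: ler_wpM2l; lra.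
have : (16 * N + M0) * 1 <= (16 * N + M0) * t by apply: ler_wpM2l; lra.
have : L * t = (16 + M0 + 300 * N) * t by rewrite LE.
have : 0 <= N * t by apply: mulr_ge0; lra.
by move: main; rewrite -/t; lra.
Qed.

Definition bounded_sol M0 u x : Prop :=
  exists p S, has_jet u x p S /\ (p != 0 -> - M0 <= nop p S <= 0).

(* Ishii-Lions: at a positive maximum of [u x - u y - L |x - y|^(1/2) - 8 |x|^2]
   the two Hessians are compared along an orthonormal basis at [x] and its
   reflection across the hyperplane orthogonal to [x - y] at [y]; the strict
   concavity of the square root then beats all other terms. *)
Lemma two_point_holder u M0 : 0 <= M0 -> (2 <= n)%N ->
  (forall x, enorm x < 1 -> {for x, continuous u} /\ bounded_sol M0 u x) ->
  (forall x, enorm x < 1 -> 0 <= u x <= 2) ->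
  forall y, enorm y <= 1 / 4 ->
    u 0 - u y <= (16 + M0 + 300 * n%:R) * Num.sqrt (enorm y).
Proof.
move=> M00 n2 uj ub y0 y0s.
have [L LE] : exists L, L = 16 + M0 + 300 * n%:R by eexists.
rewrite -LE.
have nR : (2 : R) <= n%:R by rewrite ler_nat.
have L16 : 16 <= L by rewrite LE; lra.
rewrite leNgt; apply/negP => bad.
pose A := [set x : V | enorm (x - 0) <= 1 / 2].
pose B := [set x : V | enorm (x - 0) <= 1 / 4].
have cA : compact A by apply: (@compact_enorm _ _ _ 0 (1 / 2)) => //; exact: closed_enorm_le.
have cB : compact B by apply: (@compact_enorm _ _ _ 0 (1 / 4)) => //; exact: closed_enorm_le.
(* The pair (x, y) is parametrized by x and z = x - y, and the sign is reversed: a maximum becomes a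
   minimum of [F], negative because of [bad] at (0, - y0). *)
pose F (xz : V * V) := L * Num.sqrt (enorm xz.2) + 8 * dot xz.1 xz.1 + u (xz.1 - xz.2) - u xz.1.
have inAB x z : A x -> B z -> enorm x < 1 /\ enorm (x - z) < 1.
  rewrite /A /B /= !subr0 => hx hz; split; first by apply: le_lt_trans hx _; lra.
  by apply: le_lt_trans (ler_enormB _ _) _; lra.
have [||[x z] [Ax Bz] xm] := @compact_min R _ (A `*` B) F _ (compact_setX cA cB).
- by exists (0, 0); split; rewrite /A /B /= subr0 enorm0; lra.
- move=> [x z] [Ax Bz]; have [x1 xz1] := inAB _ _ Ax Bz.
  have c1 : {for (x, z), continuous (fun p : V * V => p.1)} by exact: cvg_fst.
  have c2 : {for (x, z), continuous (fun p : V * V => p.2)} by exact: cvg_snd.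
  apply: continuousB; last first.
    by apply: (continuous_comp (f := fun p : V * V => p.1)) => //; have [] := uj _ x1.
  apply: continuousD; last first.
    apply: (continuous_comp (f := fun p : V * V => p.1 - p.2)); first exact: continuousB.
    by have [] := uj _ xz1.
  apply: continuousD.
    apply: continuousM; first exact: cst_continuous.
    apply: (continuous_comp (f := fun p : V * V => enorm p.2)); last exact: sqrt_continuous.
    by apply: (continuous_comp (f := fun p : V * V => p.2)) => //; exact: enorm_continuous.
  apply: continuousM; first exact: cst_continuous.
  apply: (continuous_comp (f := fun p : V * V => p.1) (g := fun x : V => dot x x)) => //.
  have -> : (fun x : V => dot x x) = (fun x => dot (x - 0) (x - 0)).
    by apply/funext => v; rewrite subr0.
  exact: dot_continuous.
have Fneg : F (x, z) < 0.
  apply: le_lt_trans (_ : F (0, - y0) < 0).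
    apply: xm; split; rewrite /A /B /= subr0 ?enorm0 ?enormN//; lra.
  rewrite /F /= enormN dot0l mulr0 addr0 opprK add0r; lra.
rewrite /= in Ax Bz.
have [x1 xz1] := inAB _ _ Ax Bz.
have /andP[ux0 ux2] := ub _ x1; have /andP[uy0 uy2] := ub _ xz1.
have s0 := sqrtr_ge0 (enorm z).
have Ls0 : 0 <= L * Num.sqrt (enorm z) by rewrite mulr_ge0//; lra.
(* The minimum is interior and off the diagonal: for |x| = 1/2 the penalty 8 |x|^2 = 2 covers the
   oscillation of [u], for |z| = 1/4 the term L |z|^(1/2) >= 8 does, and z = 0 gives F >= 0. *)
have x12 : enorm (x - 0) < 1 / 2.
  rewrite lt_neqAle Ax andbT; apply/eqP => xE.
  move: Fneg; rewrite /F /= -sqr_enorm -(subr0 x) xE subr0.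
  by move: ux2 uy0 Ls0; lra.
have z14 : enorm (z - 0) < 1 / 4.
  rewrite lt_neqAle Bz andbT; apply/eqP => zE.
  move: Fneg; rewrite /F /=.
  have -> : Num.sqrt (enorm z) = 1 / 2.
    rewrite -(subr0 z) zE (_ : 1 / 4 = (1 / 2) ^+ 2); last by field.
    by rewrite sqrtr_sqr ger0_norm//; lra.
  have := dot_ge0 x; move: ux2 uy0 L16; lra.
have zN0 : z - 0 != 0.
  apply/eqP => zE; move: Fneg; rewrite /F /= -[z]subr0 zE enorm0 sqrtr0 subr0.
  by have := dot_ge0 x; lra.
have {zN0}z0 : z != 0 by rewrite subr0 in zN0.
set y := x - z.
have [_ [p [Sx [xj xS]]]] := uj _ x1.
have [_ [q [Sy [yj yS]]]] := uj _ xz1.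
have J2 := @jet2_sqrt_enorm z.
set E := Num.sqrt (enorm z) in J2.
have E0 : 0 < E by rewrite sqrtr_gt0 enorm_gt0.
have zE : enorm z = E ^+ 2 by rewrite sqr_sqrtr// enorm_ge0.
have DE : dot z z = E ^+ 4 by rewrite dot_sqrt_enorm.
have E12 : E < 1 / 2.
  rewrite ltNge; apply/negP => E12.
  have : (1 / 2) ^+ 2 <= E ^+ 2.
    by apply: lerXn2r E12; rewrite nnegrE ?(ltW E0)//; lra.
  by rewrite -zE; move: z14; rewrite subr0; lra.
clear bad y0s inAB Fneg ux0 ux2 uy0 uy2 s0 Ls0 x1 xz1 uj ub cA cB.
(* Moving x along [v1] and y along [v2] independently displaces z by v1 - v2. *)
have T v1 v2 : dot p v1 - dot q v2 - L * (E * dot z (v1 - v2) / (2 * E ^+ 4)) - 16 * dot x v1 = 0 /\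
   qf Sx v1 / 2 - qf Sy v2 / 2 - L * (E * (dot (v1 - v2) (v1 - v2) / (4 * E ^+ 4)
     - 3 / 8 * dot z (v1 - v2) ^+ 2 / E ^+ 8)) - 8 * dot v1 v1 <= 0.
  have JD : jet2 (fun t => dot (x + t *: v1) (x + t *: v1)) (dot x x)
     (2 * dot x v1) (dot v1 v1).
    by apply: (jet2_ext (jet2_dot 0 x v1)) => [t|||] /=; rewrite ?subr0.
  have J := jet2D (jet2D (jet2D (xj v1) (jet2N (yj v2))) (jet2Z (- L) (J2 (v1 - v2) z0)))
    (jet2Z (- 8) JD).
  have [|H1 H2] := jet2_max J; last by split; lra.
  have N1 := near_line v1 (@open_enorm_lt R n 0 (1 / 2)) x12.
  have N2 := near_line (v1 - v2) (@open_enorm_lt R n 0 (1 / 4)) z14.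
  have N3 : \forall t \near (0 : R), 0 < enorm (z + t *: (v1 - v2) - 0).
    apply: (near_line (v1 - v2) (@open_enorm_gt R n 0 0)).
    by rewrite /= subr0 enorm_gt0.
  near=> t.
  have n1 : enorm (x + t *: v1 - 0) < 1 / 2 by near: t; exact: N1.
  have n2' : enorm (z + t *: (v1 - v2) - 0) < 1 / 4 by near: t; exact: N2.
  have n3 : 0 < enorm (z + t *: (v1 - v2)).
    by rewrite -[_ + _]subr0; near: t; exact: N3.
  have := xm (x + t *: v1, z + t *: (v1 - v2)); rewrite /F /=.
  have -> : x + t *: v1 - (z + t *: (v1 - v2)) = x - z + t *: v2.
    by apply/rowP => i; rewrite !mxE; ring.
  rewrite (@sqrt_enorm_exp (z + _)); last by rewrite -enorm_gt0.
  move=> /(_ (conj (ltW n1) (ltW n2'))); rewrite -/E.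
  move=> H.
  by move: H; rewrite -/y; lra.
have {}x12 : enorm x <= 1 / 2 by rewrite -(subr0 x) ltW.
clear - M00 n2 nR LE L16 x12 z0 xS yS E0 zE DE E12 T.
(* k z is the gradient of L |z|^(1/2). Thus q = k z and p = k z + 16 x, with |p - q| <= 8; since |q|
   >= L >= 16, also |p| >= |q| / 2. *)
pose k := L / (2 * E ^+ 3).
have k0 : 0 < k by rewrite divr_gt0// ?mulr_gt0 ?exprn_gt0//; lra.
have qE : q = k *: z.
  apply/eqP; rewrite -subr_eq0 -dot_eq0 {1}dotDl dotNl dotZl; apply/eqP.
  have [+ _] := T 0 (q - k *: z).
  rewrite ![dot _ 0]dotC !dot0l !sub0r dotNr => H.
  rewrite -[RHS]oppr0 -[in RHS]H /k; field; rewrite gt_eqF//.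
have pE : p = k *: z + 16 *: x.
  apply/eqP; rewrite -subr_eq0 -dot_eq0; set v := p - _.
  rewrite [in dot v v]/v dotDl dotNl dotDl !dotZl; apply/eqP.
  have [+ _] := T v 0.
  rewrite subr0 ![dot _ 0]dotC !dot0l => H.
  rewrite -[RHS]H /k; field; rewrite gt_eqF//.
have q0 : q != 0 by rewrite qE scaler_eq0 negb_or gt_eqF.
have qn : enorm q = L / (2 * E).
  rewrite qE enormZ gtr0_norm// zE /k; field; rewrite gt_eqF//.
have qL : L <= enorm q.
  rewrite qn ler_pdivlMr ?mulr_gt0// -[leRHS]mulr1 ler_pM2l//; lra.
have pqs : dot (p - q) (p - q) <= 64.
  have -> : p - q = 16 *: x by rewrite pE qE addrAC subrr add0r.
  rewrite dotZl dotZr -sqr_enorm.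
  by have := enorm_ge0 x; nra.
have pq8 : enorm (q - p) <= 8.
  by rewrite enormB -(@ler_pXn2r _ 2)// ?nnegrE ?enorm_ge0// sqr_enorm; lra.
have pn : enorm q / 2 <= enorm p.
  have := ler_enormD (q - p) p; rewrite subrK; lra.
have p0 : p != 0 by rewrite -enorm_gt0; lra.
have := xS p0 => /andP[xS1 _]; have := yS q0 => /andP[_ yS1].
(* [T] is used with the unit vectors along [p] and [q]: they differ by [e] with |e|^2 <= 128 /
   |q|^2, because |p - q|^2 <= 64 and |p| >= |q| / 2. The concave part of the square root is
   dropped. *)
have D : qf Sx p / dot p p - qf Sy q / dot q q <= 256 / (L * E) + 16.
  have [_] := T ((enorm p)^-1 *: p) ((enorm q)^-1 *: q).
  have np : 0 < enorm p by rewrite enorm_gt0.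
  have nq : 0 < enorm q by rewrite enorm_gt0.
  set e := _ *: p - _ *: q.
  have de := dist_unit_le p0 q0 (erefl e).
  rewrite !qfZ dotZl dotZr -(sqr_enorm p) -(sqr_enorm q).
  have -> : (enorm p)^-1 * ((enorm p)^-1 * enorm p ^+ 2) = 1 by field; rewrite gt_eqF.
  rewrite !exprVn [_^-1 * _]mulrC [(enorm q ^+ 2)^-1 * _]mulrC => H.
  have dl : dot e e <= 128 / enorm q ^+ 2.
    rewrite ler_pdivlMr ?exprn_gt0//.
    have : dot e e * (enorm q / 2 * enorm q) <= dot e e * (enorm p * enorm q).
      by rewrite ler_wpM2l ?dot_ge0// ler_pM2r.
    lra.
  have : L * (E * (dot e e / (4 * E ^+ 4) - 3 / 8 * dot z e ^+ 2 / E ^+ 8)) <= 128 / (L * E).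
    apply: (@le_trans _ _ (L / (4 * E ^+ 3) * dot e e)).
      have -> : L * (E * (dot e e / (4 * E ^+ 4) - 3 / 8 * dot z e ^+ 2 / E ^+ 8)) =
         L / (4 * E ^+ 3) * dot e e - L * (3 / 8) * (dot z e ^+ 2 / E ^+ 7).
        by field; rewrite gt_eqF.
      rewrite lerBlDr lerDl mulr_ge0//; first by lra.
      by rewrite divr_ge0 ?sqr_ge0// exprn_ge0// ltW.
    apply: (@le_trans _ _ (L / (4 * E ^+ 3) * (128 / enorm q ^+ 2))).
      by rewrite ler_wpM2l// divr_ge0 ?mulr_ge0 ?exprn_ge0 ?(ltW E0)//; lra.
    rewrite qn le_eqVlt; apply/orP; left; apply/eqP; field.
    by rewrite !gt_eqF//; lra.
  by lra.
(* A basis vector and its reflection differ by a multiple of z, the direction in which |z|^(1/2) is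
   concave; the i-th pair contributes - (L / E^7) z_i^2 + 16. *)
have TR : \tr Sx - \tr Sy <= - (L / E ^+ 3) + 16 * n%:R.
  rewrite (trace_qf Sx) (trace_qf_reflect Sy z0) -sumrB.
  apply: (@le_trans _ _ (\sum_(i < n) (- (L / E ^+ 7) * (z 0 i * z 0 i) + 16))).
    apply: ler_sum => i _.
    have [_] := T (delta_mx 0 i) (delta_mx 0 i - (2 * z 0 i / dot z z) *: z).
    rewrite subKr dot_delta_delta !dotZr dotZl DE => H.
    have {H} := H.
    have -> : L * (E * (2 * z 0 i / E ^+ 4 * (2 * z 0 i / E ^+ 4 * E ^+ 4) / (4 * E ^+ 4) -
       3 / 8 * (2 * z 0 i / E ^+ 4 * E ^+ 4) ^+ 2 / E ^+ 8)) =
       - (L / E ^+ 7) * (z 0 i * z 0 i) / 2.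
      by field; rewrite gt_eqF.
    lra.
  rewrite big_split /= -mulr_sumr -/(dot z z) DE sumr_const card_ord -[16 *+ n]mulr_natr.
  rewrite lerD2r le_eqVlt; apply/orP; left; apply/eqP.
  by field; rewrite gt_eqF.
have nn : (n - 2)%:R = n%:R - 2 :> R by rewrite natrB.
have main : - M0 <= - (L / E ^+ 3) + 16 * n%:R + (n%:R - 2) * (256 / (L * E) + 16).
  move: xS1 yS1; rewrite /nop nn -!mulrA => h1 h2.
  have h3 : (n%:R - 2) * (qf Sx p / dot p p - qf Sy q / dot q q)
     <= (n%:R - 2) * (256 / (L * E) + 16) by rewrite ler_wpM2l//; lra.
  by lra.
exact: (holder_constant_absurd nR M00 E0 E12 LE main).
Unshelve. all: by end_near.
Qed.

End Holder.

(** * Minima over spheres *)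

Section ConcaveSlope.
Context {R : realType}.
Variables (phi : R -> R) (tau : R).
Hypothesis tau0 : tau < 0.
Hypothesis phi_ge0 : forall t, tau < t -> 0 <= phi t.
Hypothesis phi_slope : forall a b c, tau < a -> a < b -> b < c ->
  (phi c - phi b) / (c - b) <= (phi b - phi a) / (b - a).

(** A negative chord slope - k would persist and push [phi] down to -1 or less at [u]. *)
Lemma concave_ge0_nondecreasing s t : tau < s -> s <= t -> phi s <= phi t.
Proof.
move=> ts; rewrite le_eqVlt => /predU1P[->//|st].
rewrite leNgt; apply/negP => pst.
pose k := (phi s - phi t) / (t - s).
have k0 : 0 < k by rewrite divr_gt0// subr_gt0.
pose u := t + (phi t + 1) / k.
have pt : 0 <= phi t by apply: phi_ge0; lra.
have tu : t < u by rewrite ltrDl divr_gt0//; lra.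
have := phi_slope ts st tu.
have -> : (phi t - phi s) / (t - s) = - k.
  by rewrite /k -mulNr opprB.
rewrite ler_pdivrMr ?subr_gt0//.
have -> : - k * (u - t) = - (phi t + 1) by rewrite /u; field; rewrite gt_eqF.
by have : 0 <= phi u by [apply: phi_ge0; lra]; lra.
Qed.

(** [m] is the infimum of the chord slopes issuing from 0. By concavity no later chord can be less
    steep, and beyond a chord of slope below m + e none is steeper than that. *)
Lemma concave_asymptotic_slope : exists m : R, [/\ 0 <= m,
  forall s t, 0 <= s -> s <= t -> m * (t - s) <= phi t - phi s &
  forall e, 0 < e -> exists2 u, 0 < u &
    forall s t, u <= s -> s <= t -> phi t - phi s <= (m + e) * (t - s)].
Proof.
pose S : set R := [set (phi t - phi 0) / t | t in [set t | 0 < t]].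
have S0 r : S r -> 0 <= r.
  move=> [t /= t0 <-]; apply: divr_ge0; last exact: ltW.
  by rewrite subr_ge0; apply: concave_ge0_nondecreasing => //; exact: ltW.
have hS : has_inf S.
  split; first by exists ((phi 1 - phi 0) / 1), 1 => //=; exact: ltr01.
  by exists 0 => r /S0.
exists (inf S); split.
- by apply: lb_le_inf; [by case: hS|exact: S0].
- move=> s t s0; rewrite le_eqVlt => /predU1P[->|st]; first by rewrite !subrr mulr0.
  rewrite -ler_pdivlMr ?subr_gt0// leNgt; apply/negP.
  set k := (phi t - phi s) / (t - s) => kS.
  set m := inf S in kS.
  (* Past the second value the line of slope k through (t, phi t) is below phi 0 + m u. *)
  pose u := Num.max (t + 1) ((phi t - k * t - phi 0) / (m - k) + 1).
  have tu : t < u by rewrite lt_max ltrDl ltr01.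
  have := phi_slope (lt_le_trans tau0 s0) st tu.
  rewrite ler_pdivrMr ?subr_gt0// -/k => h1.
  have : m <= (phi u - phi 0) / u.
    by apply: ge_inf; [by case: hS|exists u => //=; apply: le_lt_trans s0 (lt_trans st tu)].
  rewrite ler_pdivlMr => [h2|]; last exact: le_lt_trans s0 (lt_trans st tu).
  have : (m - k) * ((phi t - k * t - phi 0) / (m - k) + 1) <= (m - k) * u.
    by rewrite ler_pM2l ?subr_gt0// le_max lexx orbT.
  rewrite mulrDr mulr1 mulrC divfK ?gt_eqF ?subr_gt0//.
  by move: kS h1 h2; lra.
- move=> e e0; have [_ [u /= u0 <-] ue] := inf_adherent e0 hS.
  exists u => // s t us; rewrite le_eqVlt => /predU1P[->|st]; first by rewrite !subrr mulr0.
  rewrite -ler_pdivrMr ?subr_gt0//; apply/ltW/le_lt_trans/ue.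
  have hu c (uc : u < c) : (phi c - phi u) / (c - u) <= (phi u - phi 0) / u.
    by have := phi_slope tau0 u0 uc; rewrite subr0.
  move: us; rewrite le_eqVlt => /predU1P[us|us]; first by rewrite us in hu *; exact: hu.
  apply: le_trans (hu _ us); apply: phi_slope => //.
  exact: lt_trans u0.
Qed.

End ConcaveSlope.

Section SphereMin.
Context {R : realType} {n : nat}.
Local Notation V := 'rV[R]_n.
Variable w : V -> R.
Hypothesis n2 : (2 <= n)%N.
Hypothesis wc : forall x, pball 2 x -> {for x, continuous w}.
Hypothesis ws : forall x, pball 2 x -> supersol w x.

(** Value of [w] at a chosen minimizer on the sphere of radius e^(- t). The default 0 of [xget] is
    excluded by [sphere_minP] when t > - ln 2, that is, when the sphere lies in the domain. *)
Definition sphere_min t : R :=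
  w (xget 0 [set x | enorm x = expR (- t) /\
    forall y, enorm y = expR (- t) -> w x <= w y]).

Lemma exists_enorm (r : R) : 0 <= r -> exists x : V, enorm x = r.
Proof.
move=> r0; pose i : 'I_n := Ordinal (ltnW n2).
by exists (r *: delta_mx 0 i); rewrite enormZ enormE dot_delta_delta sqrtr1 mulr1 ger0_norm.
Qed.

Lemma expRN_lt2 (t : R) : - ln 2 < t -> expR (- t) < 2.
Proof. by move=> t2; rewrite -ltr_ln ?posrE ?expR_gt0// expRK; lra. Qed.

Lemma sphere_minP t : - ln 2 < t ->
  (exists2 x, enorm x = expR (- t) & w x = sphere_min t) /\
  (forall y, enorm y = expR (- t) -> sphere_min t <= w y).
Proof.
move=> t2; set S := [set x | enorm x = expR (- t) /\
    forall y, enorm y = expR (- t) -> w x <= w y].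
have [H1 H2] : S (xget 0 S); last by split=> //; exists (xget 0 S).
have [x0 x0E] := exists_enorm (ltW (expR_gt0 (- t))).
have cS : compact [set x : V | enorm x = expR (- t)].
  apply: (@compact_enorm _ _ _ 0 (expR (- t))); last by move=> x /= <-; rewrite subr0.
  have -> : [set x : V | enorm x = expR (- t)] =
     [set x | enorm (x - 0) <= expR (- t)] `&` [set x | expR (- t) <= enorm (x - 0)].
    apply/seteqP; split=> x /=; rewrite subr0; first by move=> ->.
    by move=> [h1 h2]; apply/eqP; rewrite eq_le h1.
  by apply: closedI; [exact: closed_enorm_le|exact: closed_enorm_ge].
have [||x xE xm] := @compact_min R V _ w _ cS.
- by exists x0.
- by move=> x /= xE; apply: wc; rewrite /pball /= xE expR_gt0 expRN_lt2.
by apply: (@xgetPex _ 0 S); exists x.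
Qed.

Lemma sphere_min_le x : pball 2 x -> sphere_min (- ln (enorm x)) <= w x.
Proof.
move=> /andP[x0 x2]; apply: (sphere_minP _).2; last by rewrite opprK lnK.
by rewrite ltrN2 ltr_ln ?posrE.
Qed.

(** Hadamard's three-circle argument: [w] is compared on an annulus with the logarithm, affine in t,
    that interpolates the minima on the two boundary spheres. Its slope may have either sign. *)
Lemma sphere_min_slope a b c : - ln 2 < a -> a < b -> b < c ->
  (sphere_min c - sphere_min b) / (c - b) <= (sphere_min b - sphere_min a) / (b - a).
Proof.
move=> a2 ab bc.
have [|_ Ma] := @sphere_minP a; first by lra.
have [|[x xE xb] _] := @sphere_minP b; first by lra.
have [|_ Mc] := @sphere_minP c; first by lra.
set fa := sphere_min a in Ma *; set fb := sphere_min b in xb *; set fc := sphere_min c in Mc *.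
pose k := (fc - fa) / (c - a).
have lnE (y : V) r : enorm y = expR (- r) -> ln (enorm (y - 0)) = - r.
  by move=> yE; rewrite subr0 yE expRK.
have H : (fa - k * a) - k * - b <= fb.
  pose K := [set y : V | enorm (y - 0) <= expR (- a)] `&` [set y | expR (- c) <= enorm (y - 0)].
  pose U := [set y : V | enorm (y - 0) < expR (- a)] `&` [set y | expR (- c) < enorm (y - 0)].
  have K2 y : K y -> pball 2 y.
    rewrite /K /= subr0 => -[h1 h2]; apply/andP; split.
      by apply: lt_le_trans h2; rewrite expR_gt0.
    by apply: le_lt_trans h1 _; apply: expRN_lt2; lra.
  have UK : U `<=` K by move=> y [h1 h2]; split; exact: ltW.
  rewrite -(lnE x b xE) -xb.
  apply: (@comparison_log R n K U w 0 k _ (expR (- c)) (expR (- a))) => //.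
  - exact: expR_gt0.
  - apply: (@compact_enorm _ _ _ 0 (expR (- a))); last by move=> y [].
    by apply: closedI; [exact: closed_enorm_le|exact: closed_enorm_ge].
  - by apply: openI; [exact: open_enorm_lt|exact: open_enorm_gt].
  - by move=> y [h1 h2]; apply/andP.
  - by move=> y /K2 /wc.
  - by move=> y /UK /K2 /ws.
  - move=> y [h1 h2] nU.
    have [ya|ya] := eqVneq (enorm (y - 0)) (expR (- a)).
      rewrite ya expRK; apply: le_trans (Ma _ _); last by rewrite -ya subr0.
      lra.
    have [yc|yc] := eqVneq (enorm (y - 0)) (expR (- c)).
      rewrite yc expRK; apply: le_trans (Mc _ _); last by rewrite -yc subr0.
      have : k * (c - a) = fc - fa by rewrite /k divfK// subr_eq0 gt_eqF//; lra.
      lra.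
    by exfalso; apply: nU; split; rewrite /= lt_neqAle ?ya ?h1// eq_sym yc.
  - by split; rewrite /= subr0 xE ler_expR; lra.
rewrite ler_pdivrMr ?subr_gt0// mulrAC ler_pdivlMr ?subr_gt0//.
have : k * (c - a) = fc - fa by rewrite /k divfK// subr_eq0 gt_eqF//; lra.
move: H; set K := k => H E.
have : (fa + K * (b - a)) * (c - a) <= fb * (c - a) by rewrite ler_pM2r; lra.
have -> : (fa + K * (b - a)) * (c - a) = fa * (c - a) + (b - a) * (K * (c - a)) by ring.
by rewrite E; lra.
Qed.

End SphereMin.

(** * Barrier for the strong maximum principle *)

Section Bounded.
Context {R : realType} {I : Type} (P : I -> Prop).
Implicit Types f g : I -> R.

(** Closed under sums and products, so that the higher-order coefficients of the barrier are bounded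
    uniformly without explicit constants. *)
Definition bnd f := exists2 G, 0 <= G & forall i, P i -> `|f i| <= G.

Lemma bnd_cst c : bnd (fun=> c).
Proof. by exists `|c|. Qed.

Lemma bndD f g : bnd f -> bnd g -> bnd (fun i => f i + g i).
Proof.
move=> [G G0 fG] [G' G'0 gG]; exists (G + G') => [|i Pi]; first exact: addr_ge0.
by apply: le_trans (ler_normD _ _) _; rewrite lerD ?fG ?gG.
Qed.

Lemma bndN f : bnd f -> bnd (fun i => - f i).
Proof. by move=> [G G0 fG]; exists G => // i Pi; rewrite normrN fG. Qed.

Lemma bndM f g : bnd f -> bnd g -> bnd (fun i => f i * g i).
Proof.
move=> [G G0 fG] [G' G'0 gG]; exists (G * G') => [|i Pi]; first exact: mulr_ge0.
by rewrite normrM ler_pM ?fG ?gG.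
Qed.

Lemma bndX f k : bnd f -> bnd (fun i => f i ^+ k).
Proof.
move=> fb; elim: k => [|k IH]; first exact: (bnd_cst 1).
have [G G0 fG] := bndM fb IH.
by exists G => // i Pi; rewrite exprS fG.
Qed.

End Bounded.

Ltac bnd_tac := repeat first [assumption | apply: bnd_cst | apply: bndD | apply: bndN
  | apply: bndM | apply: bndX].

Section Barrier.
Context {R : realType}.

(* The data on which the operator depends at a point [y], for a barrier with poles
   [0] and [c]: [|y|^2], [|y - c|^2], [<y, y - c>], and the values at [y] of
   [(|y - c|^2 / |y|)^(-n)] and of [- ln |y|]. *)
Record scal := Scal { sa : R; sd : R; sk : R; sv : R; sl : R }.

(** Half the Hessian form of the barrier along a vector u: with z = y - c, the last arguments stand
    for |u|^2, <y, u>^2, <y, u> <z, u> and <z, u>^2. The gradient is [gradY] y + [gradZ] z. *)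
Definition barrier_hess (N m ep ka : R) (x : scal) (u2 A2 AB B2 : R) : R :=
  m * (- u2 / (2 * sa x) + A2 / sa x ^+ 2) + ka *
  (sv x * (- N * (u2 / sd x - 2 * B2 / sd x ^+ 2 - u2 / (2 * sa x) + A2 / sa x ^+ 2)
     + N ^+ 2 / 2 * (4 * B2 / sd x ^+ 2 - 4 * AB / (sd x * sa x) + A2 / sa x ^+ 2))
   + ep * (2 * sl x * (- u2 / (2 * sa x) + A2 / sa x ^+ 2) + A2 / sa x ^+ 2)).

Definition gradY (N m ep ka : R) (x : scal) : R :=
  (- m + ka * (N * sv x - 2 * ep * sl x)) / sa x.

Definition gradZ (N ka : R) (x : scal) : R := ka * (- (2 * N * sv x / sd x)).

Definition grad_sq N m ep ka x : R :=
  let p := gradY N m ep ka x in let q := gradZ N ka x in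
  p ^+ 2 * sa x + 2 * p * q * sk x + q ^+ 2 * sd x.

(** Half the normalized operator times |gradient|^2, a product that is polynomial in [ka]. [A] and
    [B] are the products of the gradient with y and z. *)
Definition barrier_op N m ep ka x : R :=
  let p := gradY N m ep ka x in let q := gradZ N ka x in
  let A := p * sa x + q * sk x in let B := p * sk x + q * sd x in
  barrier_hess N m ep ka x N (sa x) (sk x) (sd x) * grad_sq N m ep ka x +
  (N - 2) * barrier_hess N m ep ka x (grad_sq N m ep ka x) (A ^+ 2) (A * B) (B ^+ 2).

(** The coefficient of [ka] in [barrier_op], whose constant term vanishes since - m ln |y| is
    n-harmonic. It is arranged so that Cauchy-Schwarz shows its sign. *)
Definition barrier_lin (N m ep : R) (x : scal) : R :=
  m ^+ 2 / sa x * (sv x * (4 * N / sd x * (1 - sk x ^+ 2 / (sa x * sd x))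
   + N ^+ 2 * (N - 1) / 2 * (2 * sk x / sd x - 1) ^+ 2 / sa x) + ep * (N - 1) / sa x).

Variables (am aM dm dM vM lM : R).
Hypotheses (am0 : 0 < am) (dm0 : 0 < dm).

Definition scal_dom x : Prop :=
  [/\ am <= sa x <= aM, dm <= sd x <= dM, sk x ^+ 2 <= sa x * sd x,
  0 <= sv x <= vM & `|sl x| <= lM].

Lemma scal_dom_gt0 x : scal_dom x -> 0 < sa x /\ 0 < sd x.
Proof.
by move=> [/andP[h1 _] /andP[h2 _] _ _ _]; split; [exact: lt_le_trans h1|exact: lt_le_trans h2].
Qed.

Lemma bnd_between (f : scal -> R) (b c : R) :
  (forall x, scal_dom x -> b <= f x <= c) -> bnd scal_dom f.
Proof.
move=> H; exists (`|b| + `|c|) => [|x /H/andP[h1 h2]]; first exact: addr_ge0.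
rewrite ler_norml; apply/andP; split.
  by have := ler_norm (- b); rewrite normrN; have := normr_ge0 c; lra.
by have := ler_norm c; have := normr_ge0 b; lra.
Qed.

Lemma barrier_expansion N m ep : exists2 G, 0 <= G &
  forall ka x, 0 < ka -> ka <= 1 -> scal_dom x ->
  m ^+ 2 / sa x - ka * G <= grad_sq N m ep ka x /\
  ka * barrier_lin N m ep x - ka ^+ 2 * G <= barrier_op N m ep ka x.
Proof.
have ba : bnd scal_dom sa by apply: (@bnd_between _ am aM) => x [].
have bai : bnd scal_dom (fun x => (sa x)^-1).
  apply: (@bnd_between _ 0 am^-1) => x Px.
  have [a0 _] := scal_dom_gt0 Px; have [/andP[h _] _ _ _ _] := Px.
  by rewrite invr_ge0 (ltW a0) lef_pV2 ?posrE.
have bd : bnd scal_dom sd by apply: (@bnd_between _ dm dM) => x [].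
have bdi : bnd scal_dom (fun x => (sd x)^-1).
  apply: (@bnd_between _ 0 dm^-1) => x Px.
  have [_ d0] := scal_dom_gt0 Px; have [_ /andP[h _] _ _ _] := Px.
  by rewrite invr_ge0 (ltW d0) lef_pV2 ?posrE.
have bk : bnd scal_dom sk.
  have [G G0 hG] := bndM ba bd.
  exists (G + 1) => [|x Px]; first exact: addr_ge0.
  have [_ _ k2 _ _] := Px.
  have := le_trans k2 (le_trans (ler_norm _) (hG _ Px)) => kG.
  rewrite -(@ler_pXn2r _ 2)// ?nnegrE ?addr_ge0//.
  rewrite real_normK ?num_real//; apply: le_trans kG _.
  by nra.
have bv : bnd scal_dom sv by apply: (@bnd_between _ 0 vM) => x [].
have bl : bnd scal_dom sl.
  by exists `|lM| => // x [_ _ _ _ h]; apply: le_trans h (ler_norm _).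
(* The final digit is the order in [ka]. [xN], [xA], [xAB], [xB] are the order-one coefficients of
   the Hessian form and [s0], [s1] its trace; in [b02], [b11], [b12] the first digit is the order of
   the Hessian, the second that of the gradient products. *)
pose P1 x := (N * sv x - 2 * ep * sl x) * (sa x)^-1.
pose Q1 x := - (2 * N * sv x * (sd x)^-1).
pose g1 x := 2 * (- m) * P1 x + 2 * (- m * (sa x)^-1) * Q1 x * sk x.
pose g2 x := P1 x ^+ 2 * sa x + 2 * P1 x * Q1 x * sk x + Q1 x ^+ 2 * sd x.
pose A1 x := P1 x * sa x + Q1 x * sk x.
pose B0 x := - m * (sa x)^-1 * sk x.
pose B1 x := P1 x * sk x + Q1 x * sd x.
pose xN x := sv x * (- N * (sd x)^-1 + N / 2 * (sa x)^-1) - ep * sl x * (sa x)^-1.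
pose xA x := sv x * (- N + N ^+ 2 / 2) * (sa x)^-1 ^+ 2
   + ep * (2 * sl x + 1) * (sa x)^-1 ^+ 2.
pose xAB x := - (2 * N ^+ 2 * sv x * (sd x)^-1 * (sa x)^-1).
pose xB x := sv x * (2 * N + 2 * N ^+ 2) * (sd x)^-1 ^+ 2.
pose s0 x := m * (- N / 2 + 1) * (sa x)^-1.
pose s1 x := xN x * N + xA x * sa x + xAB x * sk x + xB x * sd x.
pose b02 x := m * (- 2^-1 * (sa x)^-1 * g2 x + A1 x ^+ 2 * (sa x)^-1 ^+ 2).
pose b11 x := xN x * g1 x + 2 * xA x * (- m) * A1 x + xAB x * (- m * B1 x + A1 x * B0 x)
   + 2 * xB x * B0 x * B1 x.
pose b12 x := xN x * g2 x + xA x * A1 x ^+ 2 + xAB x * (A1 x * B1 x) + xB x * B1 x ^+ 2.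
pose E2 x := s0 x * g2 x + s1 x * g1 x + (N - 2) * (b02 x + b11 x).
pose E3 x := s1 x * g2 x + (N - 2) * b12 x.
have bP1 : bnd scal_dom P1 by rewrite /P1; bnd_tac.
have bQ1 : bnd scal_dom Q1 by rewrite /Q1; bnd_tac.
have bg1 : bnd scal_dom g1 by rewrite /g1; bnd_tac.
have bg2 : bnd scal_dom g2 by rewrite /g2; bnd_tac.
have bA1 : bnd scal_dom A1 by rewrite /A1; bnd_tac.
have bB0 : bnd scal_dom B0 by rewrite /B0; bnd_tac.
have bB1 : bnd scal_dom B1 by rewrite /B1; bnd_tac.
have bxN : bnd scal_dom xN by rewrite /xN; bnd_tac.
have bxA : bnd scal_dom xA by rewrite /xA; bnd_tac.
have bxAB : bnd scal_dom xAB by rewrite /xAB; bnd_tac.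
have bxB : bnd scal_dom xB by rewrite /xB; bnd_tac.
have bs0 : bnd scal_dom s0 by rewrite /s0; bnd_tac.
have bs1 : bnd scal_dom s1 by rewrite /s1; bnd_tac.
have bb02 : bnd scal_dom b02 by rewrite /b02; bnd_tac.
have bb11 : bnd scal_dom b11 by rewrite /b11; bnd_tac.
have bb12 : bnd scal_dom b12 by rewrite /b12; bnd_tac.
have bE2 : bnd scal_dom E2 by rewrite /E2; bnd_tac.
have bE3 : bnd scal_dom E3 by rewrite /E3; bnd_tac.
have bsum ka (f g : scal -> R) c d x : 0 < ka -> ka <= 1 -> `|f x| <= c -> `|g x| <= d ->
    - (ka * (c + d)) <= ka * f x + ka ^+ 2 * g x.
  clear=> k0 k1 /ler_normlP[h1 _] /ler_normlP[h2 h2'].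
  have k2 : ka ^+ 2 <= ka by rewrite expr2 ger_pMl.
  have d0 : 0 <= `|g x| by [].
  have : ka * - c <= ka * f x by rewrite ler_pM2l//; lra.
  have [gx|gx] := leP 0 (g x).
    have : 0 <= ka ^+ 2 * g x by rewrite mulr_ge0// sqr_ge0.
    have : 0 <= ka * d by apply: mulr_ge0; lra.
    by lra.
  have : (ka - ka ^+ 2) * g x <= 0 by rewrite mulr_ge0_le0// ?subr_ge0// ltW.
  have : ka * - d <= ka * g x by rewrite ler_pM2l//; lra.
  lra.
have [G1 G10 h1] := bg1; have [G2 G20 h2] := bg2.
have [G3 G30 h3] := bE2; have [G4 G40 h4] := bE3.
exists (G1 + G2 + (G3 + G4)) => [|ka x ka0 ka1 Px]; first by rewrite !addr_ge0.
have [a0 d0] := scal_dom_gt0 Px.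
have aN0 : sa x != 0 by rewrite gt_eqF.
have dN0 : sd x != 0 by rewrite gt_eqF.
have gE : grad_sq N m ep ka x = m ^+ 2 / sa x + (ka * g1 x + ka ^+ 2 * g2 x).
  by rewrite /grad_sq /gradY /gradZ /g1 /g2 /P1 /Q1; field; rewrite aN0 dN0.
have EE : barrier_op N m ep ka x =
    ka * barrier_lin N m ep x + ka * (ka * E2 x + ka ^+ 2 * E3 x).
  rewrite /barrier_op /barrier_hess gE /gradY /gradZ /barrier_lin.
  rewrite /E2 /E3 /b02 /b11 /b12 /s0 /s1 /xN /xA /xAB /xB /A1 /B0 /B1.
  rewrite /g1 /g2 /P1 /Q1.
  by field; rewrite aN0 dN0.
have i1 := bsum ka _ _ _ _ x ka0 ka1 (h1 _ Px) (h2 _ Px).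
have i2 := bsum ka _ _ _ _ x ka0 ka1 (h3 _ Px) (h4 _ Px).
rewrite gE EE; move: i1 i2.
set X := ka * g1 x + _; set Y := ka * E2 x + _; set Z := barrier_lin _ _ _ _.
have k12 : 0 <= ka * (G1 + G2) by apply: mulr_ge0; [exact: ltW|exact: addr_ge0].
have k34 : 0 <= ka * (G3 + G4) by apply: mulr_ge0; [exact: ltW|exact: addr_ge0].
have k5 := mulr_ge0 (ltW ka0) k12.
move: ka0 k12 k34 k5; clearbody X Y Z; clear => ka0 k12 k34 k5 i1 i2; split; first by lra.
have : ka * - (ka * (G3 + G4)) <= ka * Y by rewrite ler_pM2l.
by lra.
Qed.

(** The peak contributes nonnegative terms only; the strictly positive bound comes from the squared
    logarithm, which is why the barrier contains it. *)
Lemma barrier_lin_ge N m ep x : 2 <= N -> 0 < m -> 0 < ep -> scal_dom x ->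
  m ^+ 2 / aM * (ep / aM) <= barrier_lin N m ep x.
Proof.
move=> N2 m0 ep0 Px; have [a0 d0] := scal_dom_gt0 Px.
have [/andP[_ h] _ k2 /andP[v0 _] _] := Px.
have aM0 : 0 < aM by exact: lt_le_trans h.
rewrite /barrier_lin mulrDr.
have h1 : 0 <= m ^+ 2 / sa x by rewrite divr_ge0 ?sqr_ge0// ltW.
have h2 : 0 <= 1 - sk x ^+ 2 / (sa x * sd x).
  by rewrite subr_ge0 ler_pdivrMr ?mulr_gt0// mul1r.
have hi : aM^-1 <= (sa x)^-1 by rewrite lef_pV2 ?posrE.
rewrite -[leLHS]add0r; apply: lerD.
  apply: mulr_ge0 => //; apply: mulr_ge0 => //; apply: addr_ge0.
    by apply: mulr_ge0 => //; apply: divr_ge0; [lra|exact: ltW].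
  apply: divr_ge0; last exact: ltW.
  apply: mulr_ge0; last exact: sqr_ge0.
  apply: divr_ge0 => //; apply: mulr_ge0; first exact: sqr_ge0.
  by lra.
apply: ler_pM.
- by apply: divr_ge0; [exact: sqr_ge0|exact: ltW].
- by apply: divr_ge0; exact: ltW.
- by rewrite ler_pM2l ?exprn_gt0.
- apply: ler_pM => //; [exact: ltW|by rewrite invr_ge0 ltW|].
  by rewrite ler_peMr//; [exact: ltW|lra].
Qed.

(* The order [ka] term of the operator is [m^2 / a] times the linearized operator
   [Lap + (n - 2) d_rr], which is positive; higher orders are uniformly bounded. *)
Lemma barrier_scalar N m ep : 2 <= N -> 0 < m -> 0 < ep -> 0 < aM ->
  exists2 ka0, 0 < ka0 & forall ka x, 0 < ka -> ka <= ka0 -> scal_dom x ->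
    0 < grad_sq N m ep ka x /\ 0 < barrier_op N m ep ka x.
Proof.
move=> N2 m0 ep0 aM0; have [G G0 HG] := barrier_expansion N m ep.
have lin := fun x => @barrier_lin_ge N m ep x N2 m0 ep0.
have : 0 < m ^+ 2 / aM * (ep / aM) by rewrite mulr_gt0// divr_gt0// exprn_gt0.
move: lin; set mu := _ * (ep / _) => lin mu0.
have nu0 : 0 < m ^+ 2 / aM by rewrite divr_gt0// exprn_gt0.
have nuE x : scal_dom x -> m ^+ 2 / aM <= m ^+ 2 / sa x.
  move=> Px; have [a0 _] := scal_dom_gt0 Px; have [/andP[_ h] _ _ _ _] := Px.
  by rewrite ler_pM2l ?exprn_gt0// lef_pV2 ?posrE.
clearbody mu; move: nuE nu0; set nu := m ^+ 2 / aM; clearbody nu => nuE nu0.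
have G1 : 0 < G + 1 by lra.
exists (Num.min 1 (Num.min (mu / (G + 1)) (nu / (G + 1)))).
  by rewrite !lt_min ltr01 /= divr_gt0// divr_gt0.
move=> ka x ka0; rewrite !le_min !ler_pdivlMr// => /and3P[k1 k2 k3] Px.
have [h1 h2] := HG _ _ ka0 k1 Px.
split; first by have := nuE _ Px; lra.
have : ka * mu <= ka * barrier_lin N m ep x by rewrite ler_pM2l// lin.
have : ka * (ka * (G + 1)) <= ka * mu by rewrite ler_pM2l.
have : 0 < ka * ka by rewrite mulr_gt0.
by lra.
Qed.

End Barrier.

(** * Behaviour under dilations *)

Section Scaling.
Context {R : realType} {n : nat}.
Local Notation V := 'rV[R]_n.
Implicit Types (x y c : V) (w : V -> R).

Lemma has_jet_scale w x0 lam s y p S : has_jet w (x0 + lam *: y) p S ->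
  has_jet (fun y => s * w (x0 + lam *: y)) y ((s * lam) *: p) ((s * lam ^+ 2) *: S).
Proof.
move=> H u; apply: (jet2_ext (jet2Z s (H (lam *: u)))) => //.
- by move=> t /=; rewrite scalerDr !scalerA [t * lam]mulrC addrA.
- by rewrite dotZl dotZr mulrA.
- by rewrite qfZ qf_scale !mulrA.
Qed.

Lemma nop_scale k k' (p : V) S : k != 0 -> nop (k *: p) (k' *: S) = k' * nop p S.
Proof.
move=> k0; rewrite /nop mxtraceZ qf_scale qfZ dotZl dotZr mulrDr; congr (_ + _).
(* For p = 0 both quotients are 0, the inverse of 0 being 0. *)
have [->|p0] := eqVneq p 0; first by rewrite dot0l !mulr0 invr0 !mulr0.
by have := p0; rewrite -dot_eq0 => d0; field; rewrite d0.
Qed.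

Lemma supersol_scale w x0 lam s y : 0 < lam -> 0 < s ->
  supersol w (x0 + lam *: y) -> supersol (fun y => s * w (x0 + lam *: y)) y.
Proof.
move=> l0 s0 [p [S [wp wS]]].
have k0 : s * lam != 0 by rewrite mulf_neq0// gt_eqF.
exists ((s * lam) *: p), ((s * lam ^+ 2) *: S); split; first exact: has_jet_scale.
rewrite scaler_eq0 negb_or k0 /= => /wS nS.
by rewrite nop_scale// mulr_ge0_le0// mulr_ge0 ?sqr_ge0// ltW.
Qed.

Lemma bounded_sol_scale M w x0 lam s y : 0 < lam -> 0 < s ->
  bounded_sol M w (x0 + lam *: y) ->
  bounded_sol (s * lam ^+ 2 * M) (fun y => s * w (x0 + lam *: y)) y.
Proof.
move=> l0 s0 [p [S [wp wS]]].
have k0 : s * lam != 0 by rewrite mulf_neq0// gt_eqF.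
exists ((s * lam) *: p), ((s * lam ^+ 2) *: S); split; first exact: has_jet_scale.
rewrite scaler_eq0 negb_or k0 /= => /wS /andP[n1 n2].
have sl : 0 < s * lam ^+ 2 by rewrite mulr_gt0// exprn_gt0.
by rewrite nop_scale// -mulrN ler_pM2l// n1 /= pmulr_rle0.
Qed.

Lemma continuous_scale w x0 lam s y : {for x0 + lam *: y, continuous w} ->
  {for y, continuous (fun y => s * w (x0 + lam *: y))}.
Proof.
move=> wc; apply: continuousM; first exact: cst_continuous.
apply: (continuous_comp (f := fun y : V => x0 + lam *: y)) => //.
apply: continuousD; first exact: cst_continuous.
by apply: continuousZr; exact: cvg_id.
Qed.

End Scaling.

(** * Quantitative strong maximum principle on an annulus *)

Section BarrierGain.
Context {R : realType} {n : nat}.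
Local Notation V := 'rV[R]_n.
Implicit Types (x y c : V) (w W : V -> R).
Local Notation N := (n%:R : R).

Definition log_inv y : R := - (ln (dot y y) / 2).

(** The quotient |y - c|^2 / |y| is invariant under y -> y / |y|^2 when |c| = 1, so the peak is
    equally small on the spheres of radii rho and 1 / rho. *)
Definition barrier_peak c y : R :=
  expR (- N * (ln (dot (y - c) (y - c)) + log_inv y)).

Definition barrier (m ep ka b : R) c y : R :=
  b + m * log_inv y + ka * (barrier_peak c y + ep * log_inv y ^+ 2).

Definition barrier_scal c y : scal :=
  @Scal R (dot y y) (dot (y - c) (y - c)) (dot y (y - c)) (barrier_peak c y) (log_inv y).

Lemma jet2_log_inv y u : y != 0 ->
  jet2 (fun t => log_inv (y + t *: u)) (log_inv y) (- (dot y u / dot y y))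
    (- dot u u / (2 * dot y y) + dot y u ^+ 2 / dot y y ^+ 2).
Proof.
move=> y0; have d0 : dot y y != 0 by rewrite dot_eq0.
have J := jet2_ln_dot u y0; rewrite subr0 in J.
apply: (jet2_ext (jet2Z (- 2^-1) J)).
- by move=> t; rewrite /log_inv subr0 mulNr mulrC.
- by rewrite /log_inv mulNr mulrC.
- by field.
- by field.
Qed.

Lemma barrier_strict_subsol m ep ka b c y : (2 <= n)%N -> y != 0 -> y != c ->
  0 < grad_sq N m ep ka (barrier_scal c y) ->
  0 < barrier_op N m ep ka (barrier_scal c y) ->
  strict_subsol (barrier m ep ka b c) y.
Proof.
move=> n2 y0 yc; set x := barrier_scal c y => g0 o0.
pose p := gradY N m ep ka x; pose q := gradZ N ka x.
set z := y - c.
have a0 : dot y y != 0 by rewrite dot_eq0.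
have d0 : dot z z != 0 by rewrite dot_eq0 subr_eq0.
pose v := p *: y + q *: z.
have vu u : dot v u = p * dot y u + q * dot z u by rewrite /v dotDl !dotZl.
have vv : dot v v = grad_sq N m ep ka x.
  by rewrite vu (dotC y v) (dotC z v) !vu (dotC z y) /grad_sq -/p -/q /= -/z; ring.
have yv : dot y v = p * sa x + q * sk x by rewrite dotC vu (dotC z y).
have zv : dot z v = p * sk x + q * sd x by rewrite dotC vu.
exists v, (fun u => barrier_hess N m ep ka x (dot u u) (dot y u ^+ 2)
   (dot y u * dot z u) (dot z u ^+ 2)); split.
- by rewrite -dot_gt0 vv.
- move=> u.
  have J1 := jet2_log_inv u y0.
  have J2 := jet2_ln_dot u yc.
  have J := jet2D (jet2D (jet2_cst b) (jet2Z m J1)) (jet2Z ka (jet2D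
    (jet2_expE (jet2Z (- N) (jet2D J2 J1))) (jet2Z ep (jet2_sqr J1)))).
  apply: (jet2_ext J); rewrite -/z.
  + by move=> t.
  + by [].
  + rewrite vu /p /q /gradY /gradZ /= -/z -/(barrier_peak c y).
    by field; rewrite a0 d0.
  + rewrite /barrier_hess /= -/z -/(barrier_peak c y).
    by field; rewrite a0 d0.
rewrite vv yv zv.
have -> : \sum_(i < n) barrier_hess N m ep ka x (dot (delta_mx 0 i : V) (delta_mx 0 i))
   (dot y (delta_mx 0 i) ^+ 2) (dot y (delta_mx 0 i) * dot z (delta_mx 0 i))
   (dot z (delta_mx 0 i) ^+ 2) = barrier_hess N m ep ka x N (sa x) (sk x) (sd x).
  (* The form is linear in its last four arguments, so the sum over the basis can be taken inside
     them. *)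
  pose cf := (barrier_hess N m ep ka x 1 0 0 0, barrier_hess N m ep ka x 0 1 0 0,
     barrier_hess N m ep ka x 0 0 1 0, barrier_hess N m ep ka x 0 0 0 1).
  have lin u2 A2 AB B2 : barrier_hess N m ep ka x u2 A2 AB B2 =
      cf.1.1.1 * u2 + cf.1.1.2 * A2 + cf.1.2 * AB + cf.2 * B2.
    by rewrite /cf /barrier_hess /=; field; rewrite a0 d0.
  under eq_bigr do rewrite lin dot_delta_delta !expr2.
  rewrite lin !big_split /= -!mulr_sumr !dot_sum_delta sumr_const card_ord.
  by [].
rewrite natrB//.
have -> : barrier_hess N m ep ka x N (sa x) (sk x) (sd x) + (N - 2) *
    barrier_hess N m ep ka x (grad_sq N m ep ka x) ((p * sa x + q * sk x) ^+ 2)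
      ((p * sa x + q * sk x) * (p * sk x + q * sd x)) ((p * sk x + q * sd x) ^+ 2) /
    grad_sq N m ep ka x = barrier_op N m ep ka x / grad_sq N m ep ka x.
  by rewrite /barrier_op -/p -/q; set h1 := barrier_hess _ _ _ _ _ _ _ _ _;
    set h2 := barrier_hess _ _ _ _ _ _ _ _ _; field; rewrite gt_eqF.
by rewrite divr_gt0.
Qed.

Lemma log_inv_enorm y : y != 0 -> log_inv y = - ln (enorm y).
Proof. by move=> y0; rewrite ln_enorm. Qed.

Lemma barrier_peakE c y : y != 0 -> y != c ->
  barrier_peak c y = expR (- N * ln (enorm (y - c) ^+ 2 / enorm y)).
Proof.
move=> y0 yc; rewrite /barrier_peak log_inv_enorm// -sqr_enorm ln_div//.
  by rewrite posrE exprn_gt0// enorm_gt0 subr_eq0.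
by rewrite posrE enorm_gt0.
Qed.

Lemma ler_expRN_ln (s t : R) : 0 < s -> s <= t -> expR (- N * ln t) <= expR (- N * ln s).
Proof.
move=> s0 st; rewrite ler_expR !mulNr lerN2 ler_wpM2l// ler_ln// posrE//.
exact: lt_le_trans st.
Qed.

(** The barrier lies below [W] on the boundary of the annulus without the ball around [c], and
    exceeds b - e by a fixed amount on |y| = 1. The gain [g] is chosen before [c], [W], [b] and
    [e]. *)
Lemma barrier_gain m kap et rho : (2 <= n)%N -> 0 < m -> 0 < kap -> 0 < et -> et < 1 ->
  m * - ln (1 - et) <= kap / 2 -> 1 < rho -> 14 * rho <= (rho - 1) ^+ 2 ->
  exists2 g, 0 < g & forall c W b e, enorm c = 1 -> 0 <= e ->
    (forall y, rho^-1 <= enorm y <= rho -> {for y, continuous W} /\ supersol W y) ->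
    (forall y, rho^-1 <= enorm y <= rho -> b - e - m * ln (enorm y) <= W y) ->
    (forall y, enorm (y - c) <= et -> b + kap <= W y) ->
    forall y, enorm y = 1 -> b - e + g <= W y.
Proof.
move=> n2 m0 kap0 et0 et1 etk rho1 rho14.
have rho0 : 0 < rho by lra.
have lr0 : 0 < ln rho by rewrite ln_gt0.
have nR : 2 <= N by rewrite ler_nat.
(* On |y| = 1 the quotient |y - c|^2 / |y| is at most 4; on the two bounding spheres it is at least
   14, by the condition on [rho]. The value 8 lies between. *)
pose e4 := expR (- N * ln 4); pose e8 := expR (- N * ln 8); pose e14 := expR (- N * ln 14).
have lt84 : e8 < e4.
  rewrite ltr_expR !mulNr ltrN2 ltr_pM2l; last by lra.
  by rewrite ltr_ln ?posrE; lra.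
have lt148 : e14 < e8.
  rewrite ltr_expR !mulNr ltrN2 ltr_pM2l; last by lra.
  by rewrite ltr_ln ?posrE; lra.
(* With this choice the peak and the squared logarithm together stay below [e8] on the bounding
   spheres. *)
pose ep := (e8 - e14) / ln rho ^+ 2.
have ep0 : 0 < ep by rewrite divr_gt0 ?exprn_gt0// subr_gt0.
have epE : ep * ln rho ^+ 2 = e8 - e14 by rewrite /ep divfK// gt_eqF// exprn_gt0.
pose vM := expR (- N * ln (et ^+ 2 / rho)).
pose am := (rho ^+ 2)^-1; pose aM := rho ^+ 2.
have am0 : 0 < am by rewrite invr_gt0 exprn_gt0.
have aM0 : 0 < aM by rewrite exprn_gt0.
have dm0 : 0 < et ^+ 2 by rewrite exprn_gt0.
have [ka0 ka00 Hka] := @barrier_scalar R am aM (et ^+ 2) ((rho + 1) ^+ 2) vM (ln rho)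
  am0 dm0 N m ep nR m0 ep0 aM0.
have uM0 : 0 < vM + (e8 - e14) by rewrite addr_gt0 ?expR_gt0// subr_gt0.
(* Near [c] the perturbation may use half of [kap]; the condition on [et] reserves the other half
   for - m ln |y|. *)
pose ka := Num.min ka0 (kap / 2 / (vM + (e8 - e14))).
have kap2 : 0 < kap / 2 by lra.
have kaP : 0 < ka by rewrite lt_min ka00 /= divr_gt0.
have kaka0 : ka <= ka0 by rewrite ge_min lexx.
have kau : ka * (vM + (e8 - e14)) <= kap / 2.
  by rewrite -ler_pdivlMr// ge_min lexx orbT.
clearbody ka.
exists (Num.min kap (ka * (e4 - e8))).
  by rewrite lt_min kap0 /= mulr_gt0// subr_gt0.
move=> c W b e c1 e0 Wsol Wge Wc y1 y1E.
(* Lowering by ka e8 compensates the perturbation on the bounding spheres and leaves at least ka (e4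
   - e8) on |y| = 1. *)
pose B := b - e - ka * e8.
pose K := ([set y : V | rho^-1 <= enorm (y - 0)] `&` [set y | enorm (y - 0) <= rho]) `&`
   [set y | et <= enorm (y - c)].
pose U := ([set y : V | rho^-1 < enorm (y - 0)] `&` [set y | enorm (y - 0) < rho]) `&`
   [set y | et < enorm (y - c)].
have rhoV0 : 0 < rho^-1 by rewrite invr_gt0.
have KE y : K y -> [/\ rho^-1 <= enorm y <= rho, y != 0, y != c & et <= enorm (y - c)].
  rewrite /K /= subr0 => -[[h1 h2] h3]; split=> //; first exact/andP.
    by rewrite -enorm_gt0; exact: lt_le_trans h1.
  by rewrite -subr_eq0 -enorm_gt0; exact: lt_le_trans h3.
have UK : U `<=` K by move=> y [[h1 h2] h3]; split; [split|]; exact: ltW.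
have dist1 y : enorm y - 1 <= enorm (y - c).
  by have := ler_enormD (y - c) c; rewrite subrK c1; lra.
have dist2 y : 1 - enorm y <= enorm (y - c).
  by have := ler_enormD (c - y) y; rewrite subrK c1 enormB; lra.
have dist3 y : enorm (y - c) <= enorm y + 1 by rewrite -c1 ler_enormB.
have lnb y : rho^-1 <= enorm y <= rho -> - ln rho <= ln (enorm y) <= ln rho.
  move=> /andP[h1 h2]; have y0 : 0 < enorm y by exact: lt_le_trans h1.
  by rewrite -lnV ?posrE// !ler_ln ?posrE// h1.
have logsq y : K y -> log_inv y ^+ 2 <= ln rho ^+ 2.
  move=> /KE[/lnb/andP[h1 h2] y0 _ _]; rewrite log_inv_enorm// sqrrN.
  by nra.
have peakM y : K y -> barrier_peak c y <= vM.
  move=> /KE[/andP[_ h] y0 yc h3]; rewrite barrier_peakE//; apply: ler_expRN_ln.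
    by rewrite divr_gt0.
  apply: ler_pM.
  - exact: ltW.
  - exact: ltW.
  - by rewrite ler_pXn2r ?nnegrE ?enorm_ge0// ltW.
  - by rewrite lef_pV2 ?posrE// enorm_gt0.
have H : forall y, K y -> barrier m ep ka B c y <= W y.
  apply: (@comparison R n K U) => //.
  - apply: (@compact_enorm _ _ _ 0 rho); last by move=> y [[]].
    by apply: closedI; [apply: closedI|]; [exact: closed_enorm_ge|exact: closed_enorm_le|exact: closed_enorm_ge].
  - by apply: openI; [apply: openI|]; [exact: open_enorm_gt|exact: open_enorm_lt|exact: open_enorm_gt].
  - by move=> y /KE[/Wsol[]].
  - move=> y /KE[_ y0 yc _].
    have lc : {for y, continuous log_inv}.
      apply: continuousN; apply: continuousM; last exact: cst_continuous.
      have -> : (fun y : V => ln (dot y y)) = (fun y => ln (dot (y - 0) (y - 0))).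
        by apply/funext => z; rewrite subr0.
      exact: ln_dot_continuous.
    apply: continuousD.
      apply: continuousD; first exact: cst_continuous.
      by apply: continuousM => //; exact: cst_continuous.
    apply: continuousM; first exact: cst_continuous.
    apply: continuousD; last first.
      by apply: continuousM; [exact: cst_continuous|exact: continuousM].
    apply: (continuous_comp (f := fun y : V => - N * (ln (dot (y - c) (y - c)) + log_inv y))).
      apply: continuousM; first exact: cst_continuous.
      by apply: continuousD => //; exact: ln_dot_continuous.
    exact: continuous_expR.
  - move=> y Ky nU; have [h y0 yc h3] := KE _ Ky.
    have ey0 : 0 < enorm y by rewrite enorm_gt0.
    have lE := log_inv_enorm y0.
    have epl : ep * log_inv y ^+ 2 <= e8 - e14 by rewrite -epE ler_pM2l// logsq.
    clear nR lt84 lt148 epE am0 aM0 dm0 ka00 Hka uM0 kaka0 kap2.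
    have peak14 : 14 <= enorm (y - c) ^+ 2 / enorm y -> barrier m ep ka B c y <= W y.
      move=> h14; apply: le_trans (Wge _ h).
      have : barrier_peak c y <= e14.
        by rewrite barrier_peakE//; apply: ler_expRN_ln => //; lra.
      move=> hp; rewrite /barrier lE /B.
      have : ka * (barrier_peak c y + ep * log_inv y ^+ 2) <= ka * e8.
        by rewrite ler_pM2l//; lra.
      by rewrite lE; lra.
    have [yr|yr] := eqVneq (enorm y) rho.
      apply: peak14; rewrite yr ler_pdivlMr//; apply: le_trans rho14 _.
      rewrite ler_pXn2r ?nnegrE ?enorm_ge0//; last by rewrite subr_ge0 ltW.
      by rewrite -yr.
    have [yr'|yr'] := eqVneq (enorm y) rho^-1.
      apply: peak14; rewrite yr' invrK.
      have d1 : 1 - rho^-1 <= enorm (y - c) by rewrite -yr'.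
      have d2 : (1 - rho^-1) ^+ 2 <= enorm (y - c) ^+ 2.
        rewrite ler_pXn2r ?nnegrE ?enorm_ge0// subr_ge0 invf_le1//; exact: ltW.
      apply: (@le_trans _ _ ((1 - rho^-1) ^+ 2 * rho)); last by rewrite ler_pM2r.
      have -> : (1 - rho^-1) ^+ 2 * rho = (rho - 1) ^+ 2 / rho by field; rewrite gt_eqF.
      by rewrite ler_pdivlMr.
    have yet : enorm (y - c) = et.
      apply/eqP; rewrite eq_le h3 andbT leNgt; apply/negP => h4.
      case/andP: h => h1 h2; apply: nU; split; [split|] => //=; rewrite subr0.
        by rewrite lt_neqAle eq_sym yr'.
      by rewrite lt_neqAle yr.
    apply: le_trans (Wc y _); last by rewrite yet.
    have hl : m * log_inv y <= kap / 2.
      apply: le_trans etk; rewrite ler_pM2l// lE lerN2 ler_ln ?posrE//; last by lra.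
      by have := dist2 y; rewrite yet; lra.
    have hu : ka * (barrier_peak c y + ep * log_inv y ^+ 2) <= kap / 2.
      by apply: le_trans kau; rewrite ler_pM2l// lerD// peakM.
    have : 0 < ka * e8 by rewrite mulr_gt0// expR_gt0.
    by rewrite /barrier /B; lra.
  - by move=> y /UK /KE[/Wsol[]].
  - move=> y /UK Ky; have [h y0 yc h3] := KE _ Ky.
    have [|g0 o0] := Hka ka (barrier_scal c y) kaP kaka0; last exact: barrier_strict_subsol.
    split; rewrite /barrier_scal /=.
    + case/andP: h => h1 h2; rewrite -sqr_enorm /am /aM -exprVn.
      by rewrite !ler_pXn2r ?nnegrE ?enorm_ge0 ?invr_ge0 ?(ltW rho0)// h1.
    + case/andP: h => h1 h2; rewrite -sqr_enorm.
      rewrite !ler_pXn2r ?nnegrE ?enorm_ge0 ?(ltW et0)// ?h3 /=; last by lra.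
      by have := dist3 y; lra.
    + exact: dot_CS.
    + by rewrite peakM// expR_ge0.
    + rewrite log_inv_enorm// normrN ler_norml; exact: lnb.
clear Hka kaka0 ka00 uM0 kau kap2 dm0 am0 aM0 epE lt148 etk rho14 lr0 Wge Wsol logsq peakM.
have [yc|yc] := leP (enorm (y1 - c)) et.
  apply: le_trans (Wc _ yc); rewrite -addrA lerD2l.
  have : Num.min kap (ka * (e4 - e8)) <= kap by rewrite ge_min lexx.
  by lra.
have Ky : K y1.
  by split; [split|]; rewrite /= ?subr0 ?y1E; [rewrite invf_le1 ?ltW|exact: ltW|exact: ltW].
apply: le_trans (H _ Ky).
have [_ y0 y1c _] := KE _ Ky.
have : Num.min kap (ka * (e4 - e8)) <= ka * (e4 - e8) by rewrite ge_min lexx orbT.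
rewrite /barrier log_inv_enorm// y1E ln1 oppr0 mulr0 expr0n mulr0 !addr0 /B.
have : ka * e4 <= ka * barrier_peak c y1.
  rewrite ler_pM2l// barrier_peakE// y1E divr1; apply: ler_expRN_ln.
    by rewrite exprn_gt0// enorm_gt0 subr_eq0.
  have := dist3 y1; rewrite y1E => h.
  have := enorm_ge0 (y1 - c); nra.
by lra.
Qed.

End BarrierGain.

(** * Points where w is almost minimal *)

Section NearMin.
Context {R : realType} {n : nat}.
Local Notation V := 'rV[R]_n.
Variable w : V -> R.
Hypothesis n2 : (2 <= n)%N.
Hypothesis wc : forall x, pball 2 x -> {for x, continuous w}.
Hypothesis ws : forall x, pball 2 x -> supersol w x.
Hypothesis w0 : forall x, pball 2 x -> 0 <= w x.
Hypothesis winf : forall A, exists2 d, 0 < d & forall x, 0 < enorm x < d -> A <= w x.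

Local Notation phi := (sphere_min w).

Lemma sphere_min_ge0 t : - ln 2 < t -> 0 <= phi t.
Proof.
move=> t2; have [[x xE <-] _] := sphere_minP n2 wc t2.
by apply: w0; rewrite /pball /= xE expR_gt0 expRN_lt2.
Qed.

Lemma sphere_min_nondecreasing s t : - ln 2 < s -> s <= t -> phi s <= phi t.
Proof.
apply: concave_ge0_nondecreasing; first exact: sphere_min_ge0.
exact: sphere_min_slope.
Qed.

Lemma sphere_min_le_ball t x : - ln 2 < t -> 0 < enorm x -> enorm x <= expR (- t) ->
  phi t <= w x.
Proof.
move=> t2 x0 xt; have x2 : enorm x < 2 by exact: le_lt_trans xt (expRN_lt2 t2).
have : phi (- ln (enorm x)) <= w x by apply: sphere_min_le => //; rewrite /pball /= x0.
apply: le_trans; apply: sphere_min_nondecreasing => //.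
by rewrite lerNr -ler_expR lnK.
Qed.

(* Here the lower bound on [w] is constant, so a logarithm with pole at [c] is itself
   a barrier, on a ball containing [0]; [w -> +oo] takes care of the origin. *)
Lemma near_min_slope0 kap eta : 0 < kap -> 0 < eta -> eta < 1 ->
  (forall e, 0 < e -> exists2 u, 0 < u &
    forall s t, u <= s -> s <= t -> phi t - phi s <= e * (t - s)) ->
  exists2 T0, 0 < T0 & forall c, 0 < enorm c -> T0 <= - ln (enorm c) ->
    exists2 x, enorm (x - c) <= eta * enorm c & w x <= phi (- ln (enorm c)) + kap.
Proof.
move=> kap0 eta0 eta1 slope.
have l2 : 0 < ln 2 :> R by rewrite ln_gt0// ltr1n.
have l4 : ln 4 = 2 * ln 2 :> R.
  by rewrite (_ : 4 = 2 ^+ 2); [rewrite lnXn// mulr_natl|ring].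
have l8 : ln 8 = 3 * ln 2 :> R.
  by rewrite (_ : 8 = 2 ^+ 3); [rewrite lnXn// mulr_natl|ring].
pose lg := ln 4 - ln eta.
have lge : ln eta < 0 by rewrite ln_lt0// eta0.
have lg0 : 0 < lg by rewrite /lg; lra.
(* The logarithm of this slope drops by exactly [kap] from |x - c| = eta r to |x - c| = 4 r. *)
pose a := kap / lg.
have a0 : 0 < a by rewrite divr_gt0.
have aE : a * lg = kap by rewrite /a divfK// gt_eqF.
(* With slope a / 6, [phi] grows by at most (a / 2) ln 2 from T - ln 8 to T, half of what the
   barrier gains at distance 2 r from [c]. *)
have e0 : 0 < a / 6 by rewrite divr_gt0.
have [u u0 hu] := slope _ e0.
exists (u + ln 8) => [|c c0 Tc]; first by lra.
set r := enorm c in c0 Tc *; set T := - ln r in Tc *.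
apply: contrapT => nex.
have far x : enorm (x - c) <= eta * r -> phi T + kap < w x.
  by move=> xc; rewrite ltNge; apply/negP => wx; apply: nex; exists x.
have T8 : 0 < T - ln 8 by lra.
have T82 : - ln 2 < T - ln 8 by lra.
have T2 : - ln 2 < T by lra.
pose A := phi (T - ln 8).
have rT : expR (- T) = r by rewrite /T opprK lnK.
have r8 : expR (- (T - ln 8)) = 8 * r.
  by rewrite opprB expRD lnK ?posrE// rT.
have r81 : 8 * r < 2 by rewrite -r8; exact: expRN_lt2.
have Aw x : 0 < enorm x -> enorm x <= 8 * r -> A <= w x.
  by move=> x0 xr; apply: sphere_min_le_ball => //; rewrite r8.
have AT : A <= phi T by apply: sphere_min_nondecreasing => //; lra.
have [d d0 hd] := winf (A + kap).
(* A ball around the origin is cut out on whose boundary w >= A + kap; its radius is at most r, so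
   that the minimizer [xs] remains in [K]. *)
pose e1 := Num.min (d / 2) r.
have e10 : 0 < e1 by rewrite lt_min divr_gt0.
have [xs xsE wxs] := (sphere_minP n2 wc T2).1; rewrite rT in xsE.
have [xsc|xsc] := leP (enorm (xs - c)) (eta * r).
  by have := far _ xsc; rewrite wxs; lra.
have xs2 : enorm (xs - c) <= 2 * r.
  by apply: le_trans (ler_enormB _ _) _; rewrite xsE -/r; lra.
pose K := ([set x : V | enorm (x - c) <= 4 * r] `&` [set x | eta * r <= enorm (x - c)])
  `&` [set x | e1 <= enorm (x - 0)].
pose U := ([set x : V | enorm (x - c) < 4 * r] `&` [set x | eta * r < enorm (x - c)])
  `&` [set x | e1 < enorm (x - 0)].
have etar : 0 < eta * r by rewrite mulr_gt0.
have UK : U `<=` K by move=> y [[h1 h2] h3]; split; [split|]; exact: ltW.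
have KE x : K x -> [/\ 0 < enorm x, enorm x <= 8 * r & pball 2 x].
  rewrite /K /= subr0 => -[[h1 h2] h3].
  have x0 : 0 < enorm x by exact: lt_le_trans h3.
  have x8 : enorm x <= 8 * r.
    by have := ler_enormD (x - c) c; rewrite subrK -/r; lra.
  by split=> //; rewrite /pball /= x0; exact: le_lt_trans r81.
have lnr : ln (4 * r) - ln (eta * r) = lg by rewrite !lnM ?posrE// /lg; ring.
have H : A + a * ln (4 * r) - a * ln (enorm (xs - c)) <= w xs.
  apply: (@comparison_log R n K U w c a _ (eta * r) (4 * r)) => //.
  - apply: (@compact_enorm _ _ _ c (4 * r)); last by move=> x [[]].
    by apply: closedI; [apply: closedI|]; [exact: closed_enorm_le|exact: closed_enorm_ge|exact: closed_enorm_ge].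
  - by apply: openI; [apply: openI|]; [exact: open_enorm_lt|exact: open_enorm_gt|exact: open_enorm_gt].
  - by move=> x [[h1 h2] _]; apply/andP.
  - by move=> x /KE[_ _ /wc].
  - by move=> x /UK /KE[_ _ /ws].
  - move=> x Kx nU; have [x0 x8 _] := KE _ Kx; have [[h1 h2] h3] := Kx.
    have [xe|xe] := eqVneq (enorm (x - c)) (eta * r).
      rewrite xe; apply: le_trans (ltW (far _ _)); last by rewrite xe.
      by rewrite -addrA -mulrBr lnr aE; lra.
    have [xr|xr] := eqVneq (enorm (x - c)) (4 * r).
      by rewrite xr addrK; exact: Aw.
    have xe1 : enorm x = e1.
      apply/eqP; rewrite eq_le; rewrite /= subr0 in h3; rewrite h3 andbT leNgt.
      apply/negP => h4; apply: nU; split; [split|]; rewrite /= ?subr0//.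
        by rewrite lt_neqAle xr.
      by rewrite lt_neqAle eq_sym xe.
    apply: (@le_trans _ _ (A + kap)).
      rewrite -addrA lerD2l -aE -lnr mulrBr lerD2l lerN2 ler_pM2l// ler_ln ?posrE//.
      by apply: lt_le_trans etar h2.
    apply: hd; rewrite x0 xe1 /=; apply: (@le_lt_trans _ _ (d / 2)); last by lra.
    by rewrite ge_min lexx.
  - split; [split|]; rewrite /=; [lra|exact: ltW|].
    by rewrite subr0 xsE ge_min lexx orbT.
have h1 : a * ln (enorm (xs - c)) <= a * (ln 2 + ln r).
  rewrite ler_pM2l// -lnM ?posrE// ler_ln ?posrE ?mulr_gt0//.
  exact: lt_trans etar xsc.
move: H; rewrite wxs lnM ?posrE// l4 => H.
clear far Aw hd KE UK lnr xsc xs2 etar d0 e10 r81 kap0 eta0 eta1 lge lg0 aE.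
have h2 : phi T - A <= a / 6 * (T - (T - ln 8)) by apply: hu; lra.
have h3 : 0 < a * ln 2 by rewrite mulr_gt0.
by move: h2; rewrite l8; lra.
Qed.

(** After scaling by |c|, [w] is above phi T - m ln |y| up to g / 2. If it were large on the whole
    ball around [c], the gain [g] would put it above phi T + g / 2 on the sphere where its minimum
    is phi T. *)
Lemma near_min_slope_gt0 m kap eta : 0 < m -> 0 < kap -> 0 < eta -> eta < 1 ->
  (forall s t, 0 <= s -> s <= t -> m * (t - s) <= phi t - phi s) ->
  (forall e, 0 < e -> exists2 u, 0 < u &
    forall s t, u <= s -> s <= t -> phi t - phi s <= (m + e) * (t - s)) ->
  exists2 T0, 0 < T0 & forall c, 0 < enorm c -> T0 <= - ln (enorm c) ->
    exists2 x, enorm (x - c) <= eta * enorm c & w x <= phi (- ln (enorm c)) + kap.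
Proof.
move=> m0 kap0 eta0 eta1 hm slope.
(* The second value makes - m ln (1 - et) at most kap / 2. *)
pose et := Num.min eta (1 - expR (- (kap / (2 * m)))).
have k2m : 0 < kap / (2 * m) by rewrite divr_gt0// mulr_gt0.
have et0 : 0 < et.
  by rewrite lt_min eta0 /= subr_gt0 -[ltRHS]expR0 ltr_expR oppr_lt0.
have eteta : et <= eta by rewrite ge_min lexx.
have etk : m * - ln (1 - et) <= kap / 2.
  have : expR (- (kap / (2 * m))) <= 1 - et.
    by rewrite lerBrDl -lerBrDr ge_min lexx orbT.
  rewrite -ler_ln ?posrE ?expR_gt0//; last by rewrite subr_gt0; lra.
  rewrite expRK => h.
  apply: (@le_trans _ _ (m * (kap / (2 * m)))); last by rewrite le_eqVlt; apply/orP; left; apply/eqP; field; rewrite gt_eqF.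
  by rewrite ler_pM2l//; lra.
have et1 : et < 1 by exact: le_lt_trans eta1.
(* 16 is the least integer above 1 allowed by the condition on [rho]: 14 * 16 = 224 <= 15^2. *)
have [rho rhoE] : exists rho : R, rho = 16 by eexists.
have rho1 : 1 < rho by rewrite rhoE; lra.
have rho14 : 14 * rho <= (rho - 1) ^+ 2 by rewrite rhoE; lra.
have rho_gt0 : 0 < rho by lra.
have [g g0 gain] := barrier_gain n2 m0 kap0 et0 et1 etk rho1 rho14.
have lr0 : 0 < ln rho by rewrite ln_gt0.
have e0 : 0 < g / (2 * ln rho) by rewrite divr_gt0// mulr_gt0.
have [u u0 hu] := slope _ e0.
exists (u + ln rho) => [|c c0 Tc]; first by lra.
set r := enorm c in c0 Tc *; set T := - ln r in Tc *.
apply: contrapT => nex.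
have far x : enorm (x - c) <= eta * r -> phi T + kap < w x.
  by move=> xc; rewrite ltNge; apply/negP => wx; apply: nex; exists x.
have T0 : 0 < T by lra.
have T2 : - ln 2 < T.
  by have : 0 < ln 2 :> R by [rewrite ln_gt0// ltr1n]; lra.
have rT : expR (- T) = r by rewrite /T opprK lnK.
have rr1 : rho * r <= 1.
  rewrite -rT -[X in X * _](@lnK _ rho) ?posrE// -expRD -expR0 ler_expR; lra.
have pb (y : V) : rho^-1 <= enorm y <= rho -> pball 2 (0 + r *: y).
  move=> /andP[h1 h2]; rewrite /pball /= add0r enormZ gtr0_norm//.
  have y0 : 0 < enorm y by apply: lt_le_trans h1; rewrite invr_gt0.
  rewrite mulr_gt0//=; have : r * enorm y <= r * rho by rewrite ler_pM2l.
  by lra.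
have lnb (y : V) : rho^-1 <= enorm y <= rho -> - ln rho <= ln (enorm y) <= ln rho.
  move=> /andP[h1 h2]; have y0 : 0 < enorm y.
    by apply: lt_le_trans h1; rewrite invr_gt0.
  by rewrite -lnV ?posrE// !ler_ln ?posrE ?invr_gt0// h1.
clear etk et0 k2m kap0 eta0 eta1 rho1 rho14 nex rr1.
have [xs xsE wxs] := (sphere_minP n2 wc T2).1; rewrite rT in xsE.
have cE : enorm (r^-1 *: c) = 1.
  by rewrite enormZ -/r gtr0_norm ?invr_gt0// mulVf// gt_eqF.
have g20 : 0 <= g / 2 by lra.
have : phi T - g / 2 + g <= 1 * w (0 + r *: (r^-1 *: xs)).
  apply: (gain (r^-1 *: c) (fun y => 1 * w (0 + r *: y)) (phi T) (g / 2) cE g20).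
  - move=> y /pb hy; split; first by apply: continuous_scale; exact: wc.
    by apply: supersol_scale => //; exact: ws.
  - move=> y hy; rewrite mul1r; have pby := pb _ hy.
    have := sphere_min_le n2 wc pby; apply: le_trans.
    have y0 : 0 < enorm y by case/andP: hy => h1 _; apply: lt_le_trans h1; rewrite invr_gt0.
    rewrite add0r enormZ gtr0_norm// lnM ?posrE// opprD -/T.
    have /andP[h1 h2] := lnb _ hy.
    (* For |y| <= 1 the lower slope bound m suffices. For |y| > 1, [phi] falls with slope at most m
       + g / (2 ln rho) over a length at most ln rho, which accounts for the error g / 2. *)
    have [h|h] := leP (ln (enorm y)) 0.
      have := hm T (T - ln (enorm y)) (ltW T0); rewrite lerDl oppr_ge0 => /(_ h).
      by lra.
    have h3 : phi T - phi (T - ln (enorm y)) <=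
        (m + g / (2 * ln rho)) * (T - (T - ln (enorm y))) by apply: hu; lra.
    have h4 : g / (2 * ln rho) * ln (enorm y) <= g / 2.
      apply: (@le_trans _ _ (g / (2 * ln rho) * ln rho)); first by rewrite ler_pM2l.
      by rewrite le_eqVlt; apply/orP; left; apply/eqP; field; rewrite gt_eqF.
    by move: h3 h4; lra.
  - move=> y yc; rewrite mul1r add0r; apply/ltW/far.
    have -> : r *: y - c = r *: (y - r^-1 *: c).
      by rewrite scalerBr scalerA divff ?scale1r// gt_eqF.
    rewrite enormZ gtr0_norm// mulrC ler_pM2r//; exact: le_trans eteta.
  - by rewrite enormZ xsE gtr0_norm ?invr_gt0// mulVf// gt_eqF.
rewrite mul1r add0r scalerA divff ?scale1r ?gt_eqF// wxs; lra.
Qed.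

Lemma near_min m kap eta : 0 <= m -> 0 < kap -> 0 < eta -> eta < 1 ->
  (forall s t, 0 <= s -> s <= t -> m * (t - s) <= phi t - phi s) ->
  (forall e, 0 < e -> exists2 u, 0 < u &
    forall s t, u <= s -> s <= t -> phi t - phi s <= (m + e) * (t - s)) ->
  exists2 T0, 0 < T0 & forall c, 0 < enorm c -> T0 <= - ln (enorm c) ->
    exists2 x, enorm (x - c) <= eta * enorm c & w x <= phi (- ln (enorm c)) + kap.
Proof.
rewrite le_eqVlt => /predU1P[<-|m0] kap0 eta0 eta1 hm slope.
  by apply: near_min_slope0 => // e /slope[u u0 hu]; exists u => // s t; rewrite -[e]add0r; exact: hu.
exact: near_min_slope_gt0 hm slope.
Qed.

End NearMin.

(** * Upper bound *)

Section UpperBound.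
Context {R : realType} {n : nat}.
Local Notation V := 'rV[R]_n.
Variable w : V -> R.
Variable C : R.
Hypothesis C0 : 0 <= C.
Hypothesis n2 : (2 <= n)%N.
Hypothesis wc : forall x, pball 2 x -> {for x, continuous w}.
Hypothesis wb : forall x, pball 2 x -> bounded_sol (C * expR (2 * w x)) w x.
Hypothesis w0 : forall x, pball 2 x -> 0 <= w x.

Lemma bounded_sol_supersol M (u : V -> R) x : bounded_sol M u x -> supersol u x.
Proof. by move=> [p [S [uj H]]]; exists p, S; split=> // /H/andP[]. Qed.

Lemma bounded_solW M M' (u : V -> R) x : M <= M' -> bounded_sol M u x -> bounded_sol M' u x.
Proof.
move=> MM [p [S [uj H]]]; exists p, S; split=> // /H/andP[h ->].
by rewrite andbT; apply: le_trans h; rewrite lerN2.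
Qed.

Let ws x (x2 : pball 2 x) : supersol w x := bounded_sol_supersol (wb x2).

(* Choosing the maximum of [(rho - |x - c|) e^w] makes [e^w] at most double on a
   ball around [x0] of radius at least a multiple of [rho e^(- w x0)]. *)
Lemma spike_selection c rho : 0 < rho -> (forall x, enorm (x - c) <= rho -> pball 2 x) ->
  exists x0, [/\ enorm (x0 - c) <= rho, w c <= w x0 &
    forall x, enorm (x - x0) <= rho * expR (- w x0) / 2 ->
      enorm (x - c) <= rho /\ w x <= w x0 + ln 2].
Proof.
move=> rho0 rhoB.
pose B := [set x : V | enorm (x - c) <= rho].
have cB : compact B.
  by apply: (@compact_enorm _ _ _ c rho) => //; exact: closed_enorm_le.
have Bc : B c by rewrite /B /= subrr enorm0 ltW.
pose f x := - ((rho - enorm (x - c)) * expR (w x)).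
have [||x0 Bx0 x0m] := @compact_min R V B f _ cB.
- by exists c.
- move=> x Bx; apply: continuousN; apply: continuousM.
    by apply: continuousB; [exact: cst_continuous|exact: enormB_continuous].
  apply: (continuous_comp (f := w)); first by apply: wc; exact: rhoB.
  exact: continuous_expR.
have fc := x0m _ Bc; rewrite /f lerN2 subrr enorm0 subr0 in fc.
set d := rho - enorm (x0 - c) in fc.
have d_rho : d <= rho by rewrite /d gerBl enorm_ge0.
have wwc : w c <= w x0.
  rewrite -ler_expR -(ler_pM2l rho0); apply: le_trans fc _.
  by rewrite ler_wpM2r// ltW// expR_gt0.
have wc0 : 0 <= w c by apply/w0/rhoB.
(* As w c >= 0, maximality against [c] bounds from below the distance of [x0] to the boundary of the
   ball. *)
have drho : rho * expR (- w x0) <= d.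
  rewrite expRN ler_pdivrMr ?expR_gt0//; apply: le_trans fc.
  by rewrite ler_peMr ?(ltW rho0)// -expR0 ler_expR.
have d0 : 0 < d by apply: lt_le_trans drho; rewrite mulr_gt0// expR_gt0.
exists x0; split=> // x xx0.
have xd : enorm (x - x0) <= d / 2 by lra.
have xc : d / 2 <= rho - enorm (x - c).
  by have := ler_enorm_dist x x0 c; move: xd; rewrite /d; lra.
have Bx : B x by rewrite /B /=; lra.
split=> //; have := x0m _ Bx; rewrite /f lerN2 -/d => h.
have h1 : d / 2 * expR (w x) <= d * expR (w x0).
  by apply: le_trans h; rewrite ler_wpM2r// ltW// expR_gt0.
rewrite -ler_expR expRD lnK ?posrE// -(ler_pM2l d0); lra.
Qed.

(* On the doubling ball of radius [lam] the rescaled function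
   [y |-> w (x0 + lam y) / w x0] satisfies the hypotheses of [two_point_holder]
   with constants independent of [x0]. *)
Lemma spike_width del : 0 < del -> exists2 sig, 0 < sig <= 1 / 4 &
  forall c rho, 0 < rho -> rho <= 1 -> 1 <= w c ->
  (forall x, enorm (x - c) <= rho -> pball 2 x) ->
  exists x0, [/\ enorm (x0 - c) <= rho, w c <= w x0 &
    forall x, enorm (x - x0) <= sig * (rho * expR (- w x0) / 2) ->
      (1 - del) * w x0 <= w x].
Proof.
move=> del0; have [L LE] : exists L, L = 16 + 4 * C + 300 * n%:R by eexists.
have nR : 0 <= n%:R :> R by exact: ler0n.
have L0 : 0 < L by move: C0 nR; rewrite LE; lra.
exists (Num.min (1 / 4) ((del / L) ^+ 2)).
  by rewrite ge_min lexx lt_min exprn_gt0 ?divr_gt0.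
set sig := Num.min _ _ => c rho rho0 rho1 wc1 rhoB.
have sig4 : sig <= 1 / 4 by rewrite ge_min lexx.
have sigd : L * Num.sqrt sig <= del.
  rewrite mulrC -ler_pdivlMr// -[leRHS]ger0_norm; last by rewrite divr_ge0 ?ltW.
  by rewrite -sqrtr_sqr ler_wsqrtr// ge_min lexx orbT.
have [x0 [x0c wx0 dbl]] := spike_selection rho0 rhoB.
exists x0; split=> // x xx0.
set W0 := w x0 in wx0 dbl xx0 *.
have W1 : 1 <= W0 by exact: le_trans wx0.
have W0gt : 0 < W0 by lra.
set lam := rho * expR (- W0) / 2 in dbl xx0.
have lam0 : 0 < lam by rewrite divr_gt0// mulr_gt0// expR_gt0.
have lamE : lam ^+ 2 * expR (2 * W0) = rho ^+ 2 / 4.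
  rewrite /lam expRN [2 * W0]mulr_natl mulr2n expRD; field.
  by rewrite gt_eqF// expR_gt0.
have inb y : enorm y < 1 -> enorm (x0 + lam *: y - x0) <= lam.
  by move=> y1; rewrite addrAC subrr add0r enormZ gtr0_norm// ger_pMr// ltW.
pose u (y : V) := W0^-1 * w (x0 + lam *: y).
have ln21 : ln 2 <= 1 :> R.
  by have := @le_ln1Dx R 1; rewrite (_ : 1 + 1 = 2 :> R)//; apply; lra.
have uH y : enorm y <= 1 / 4 -> u 0 - u y <= L * Num.sqrt (enorm y).
  rewrite LE; apply: two_point_holder => //; first by rewrite mulr_ge0.
  - move=> z /inb /dbl[/rhoB zB wz]; split.
      by apply: continuous_scale; exact: wc.
    (* On the doubling ball e^(2 w) <= 4 e^(2 W0), and lam^2 e^(2 W0) = rho^2 / 4, so the rescaled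
       bound is at most C rho^2 / W0 <= C. *)
    apply: (@bounded_solW (W0^-1 * lam ^+ 2 * (C * expR (2 * w (x0 + lam *: z))))); last first.
      by apply: bounded_sol_scale => //; [rewrite invr_gt0|exact: wb].
    have h1 : expR (2 * w (x0 + lam *: z)) <= 4 * expR (2 * W0).
      have -> : 4 * expR (2 * W0) = expR (2 * (W0 + ln 2)).
        rewrite mulrDr expRD mulrC; congr (_ * _).
        by rewrite [2 * ln 2]mulr_natl mulr2n expRD !lnK ?posrE//; ring.
      by rewrite ler_expR ler_pM2l.
    have h2 : W0^-1 * lam ^+ 2 * (C * (4 * expR (2 * W0))) = C * (rho ^+ 2 * W0^-1).
      transitivity (4 * W0^-1 * C * (lam ^+ 2 * expR (2 * W0))); first by ring.
      by rewrite lamE; field; rewrite gt_eqF.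
    apply: (@le_trans _ _ (C * (rho ^+ 2 * W0^-1))).
      rewrite -h2; apply: ler_wpM2l; last by apply: ler_wpM2l.
      by rewrite mulr_ge0 ?sqr_ge0// invr_ge0 ltW.
    apply: (@le_trans _ _ (C * 1)); last by move: C0; lra.
    apply: ler_wpM2l => //; rewrite ler_pdivrMr// mul1r; apply: le_trans W1.
    by rewrite exprn_ile1// ltW.
  - move=> z /inb /dbl[/rhoB zB wz]; rewrite /u; apply/andP; split.
      by rewrite mulr_ge0 ?invr_ge0 ?(ltW W0gt)// w0.
    by rewrite mulrC ler_pdivrMr//; lra.
pose y := lam^-1 *: (x - x0).
have xE : x = x0 + lam *: y.
  by rewrite /y scalerA divff ?gt_eqF// scale1r addrC subrK.
have ys : enorm y <= sig.
  by rewrite /y enormZ gtr0_norm ?invr_gt0// mulrC ler_pdivrMr.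
have := uH y (le_trans ys sig4).
rewrite /u scaler0 addr0 -xE -/W0 mulVf ?gt_eqF// => h.
have h1 : 1 - W0^-1 * w x <= del.
  apply: le_trans h (le_trans _ sigd); rewrite ler_pM2l// ler_wsqrtr//.
have : W0 * (1 - W0^-1 * w x) <= W0 * del by rewrite ler_pM2l.
by rewrite mulrBr mulrA divff ?gt_eqF// mul1r mulr1; lra.
Qed.

(** The barrier is the logarithm around [x0] equal to [B] at radius s and to [A] at radius 4 rho.
    The ball around [c] is within 2 rho of [x0], where a factor 2 in the radius is still to be
    gained. *)
Lemma spike_gap c x0 rho s A B : 0 < s -> s <= rho -> enorm (x0 - c) <= rho -> A <= B ->
  (forall x, enorm (x - c) <= 5 * rho -> pball 2 x /\ A <= w x) ->
  (forall x, enorm (x - x0) <= s -> B <= w x) ->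
  forall x, enorm (x - c) <= rho -> A + (B - A) / (ln (4 * rho) - ln s) * ln 2 <= w x.
Proof.
move=> s0 srho x0c AB wA wB xb xbc.
have rho0 : 0 < rho by exact: lt_le_trans srho.
have r40 : 0 < 4 * rho by lra.
have l2 : 0 < ln 2 :> R by rewrite ln_gt0// ltr1n.
have ln4 : ln (4 * rho) = ln 2 + ln (2 * rho).
  have -> : 4 * rho = 2 * (2 * rho) by ring.
  by rewrite (lnM (x := 2)) ?posrE// mulr_gt0.
have lns : ln s <= ln (2 * rho) by rewrite ler_ln ?posrE//; lra.
set lg := ln (4 * rho) - ln s.
have lg2 : ln 2 <= lg by rewrite /lg; lra.
have lg0 : 0 < lg by exact: lt_le_trans lg2.
pose a := (B - A) / lg.
have aE : a * lg = B - A by rewrite /a divfK// gt_eqF.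
have a0 : 0 <= a by apply: divr_ge0; [rewrite subr_ge0|exact: ltW].
rewrite -/a.
have [xbs|xbs] := leP (enorm (xb - x0)) s.
  apply: le_trans (wB _ xbs).
  by rewrite addrC -lerBrDr -aE ler_wpM2l.
pose K := [set x : V | enorm (x - x0) <= 4 * rho] `&` [set x | s <= enorm (x - x0)].
pose U := [set x : V | enorm (x - x0) < 4 * rho] `&` [set x | s < enorm (x - x0)].
have UK : U `<=` K by move=> y [h1 h2]; split; exact: ltW.
have K5 x : enorm (x - x0) <= 4 * rho -> enorm (x - c) <= 5 * rho.
  by move=> h; have := ler_enorm_dist x x0 c; lra.
have KB x : K x -> pball 2 x by move=> [/K5/wA[]].
have xb2 : enorm (xb - x0) <= 2 * rho.
  by have := ler_enorm_dist xb c x0; rewrite (enormB c); lra.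
have H : A + a * ln (4 * rho) - a * ln (enorm (xb - x0)) <= w xb.
  apply: (@comparison_log R n K U w x0 a _ s (4 * rho)) => //.
  - apply: (@compact_enorm _ _ _ x0 (4 * rho)); last by move=> x [].
    by apply: closedI; [exact: closed_enorm_le|exact: closed_enorm_ge].
  - by apply: openI; [exact: open_enorm_lt|exact: open_enorm_gt].
  - by move=> x [h1 h2]; apply/andP.
  - by move=> x /KB /wc.
  - by move=> x /UK /KB /ws.
  - move=> x [h1 h2] nU.
    have [xe|xe] := eqVneq (enorm (x - x0)) s.
      by rewrite xe -addrA -mulrBr aE addrCA subrr addr0; apply: wB; rewrite xe.
    have [xr|xr] := eqVneq (enorm (x - x0)) (4 * rho).
      by rewrite xr addrK; apply: (wA _ _).2; exact: K5.
    exfalso; apply: nU; split; rewrite /=; first by rewrite lt_neqAle xr.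
    by rewrite lt_neqAle eq_sym xe.
  - by split; rewrite /=; [lra|exact: ltW].
apply: le_trans H; rewrite -addrA lerD2l -mulrBr ler_wpM2l//.
have : ln (enorm (xb - x0)) <= ln (2 * rho).
  by rewrite ler_ln ?posrE ?mulr_gt0//; exact: lt_trans xbs.
by lra.
Qed.

(** With k = del / (m + del), p <= (1 - 3 k / 4) W while B = (1 - k / 4) W, so the height is at
    least k W / 2. The logarithmic width W + sl is at most 2 W, hence a slope of at least k / 4. *)
Lemma spike_gap_large (m del T W p sh sl l : R) : 0 <= m -> 0 < del -> 0 <= T ->
  (m + del) * T <= W -> 1 <= W -> p <= (m + del / 4) * T -> 0 <= sh -> 0 <= sl -> sl <= W ->
  0 <= l ->
  let B := (1 - del / (m + del) / 4) * W in
  p - sh <= B /\ l * (del / (m + del) / 4) <= (B - (p - sh)) / (W + sl) * l.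
Proof.
move=> m0 del0 T0 TW W1 pT sh0 sl0 slW l0.
have md0 : 0 < m + del by lra.
have [k kE] : exists k, k = del / (m + del) by eexists.
have k0 : 0 < k by rewrite kE divr_gt0.
have kmd : (m + del) * k = del by rewrite kE mulrC divfK// gt_eqF.
have k1 : k <= 1 by rewrite kE ler_pdivrMr//; lra.
rewrite -kE /=; set B := (1 - k / 4) * W.
have gap : k / 2 * W <= B - (p - sh).
  have mE : m + del / 4 = (1 - 3 / 4 * k) * (m + del) by lra.
  have : (1 - 3 / 4 * k) * ((m + del) * T) <= (1 - 3 / 4 * k) * W.
    by apply: ler_wpM2l => //; lra.
  by move: pT; rewrite mE /B -mulrA; lra.
have kW : 0 <= k / 2 * W by apply: mulr_ge0; lra.
split; first by rewrite -subr_ge0; exact: le_trans gap.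
rewrite mulrC ler_wpM2r// ler_pdivlMr; last by lra.
apply: le_trans gap.
have : k / 4 * (W + sl) <= k / 4 * (2 * W) by by rewrite ler_pM2l ?divr_gt0//; lra.
by lra.
Qed.

Hypothesis winf : forall A, exists2 d, 0 < d & forall x, 0 < enorm x < d -> A <= w x.

Local Notation phi := (sphere_min w).

Lemma near_sphere_min_le m u c eta : (forall s t, u <= s -> s <= t ->
    phi t - phi s <= m * (t - s)) -> 0 < u -> 0 < eta -> eta <= 1 / 20 ->
  0 < enorm c -> enorm c < 1 -> u + 1 <= - ln (enorm c) ->
  forall x, enorm (x - c) <= 5 * (eta * enorm c) ->
    pball 2 x /\ phi (- ln (enorm c)) - 5 * m * eta <= w x.
Proof.
move=> hu u0 eta0 eta20; set r := enorm c; set T := - ln r => r0 r1 Tu x xc.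
have er : eta * r <= 1 / 20 * r by rewrite ler_pM2r.
have x0 : 0 < enorm x.
  by have := ler_enormD (c - x) x; rewrite subrK enormB -/r; lra.
have xr : enorm x <= r * (1 + 5 * eta).
  by have := ler_enormD (x - c) c; rewrite subrK -/r; lra.
split; first by rewrite /pball /= x0 /=; lra.
have l2 : 0 < ln 2 :> R by rewrite ln_gt0// ltr1n.
have h1 : phi (T - 5 * eta) <= w x.
  apply: (sphere_min_le_ball n2 wc ws w0) => //; first by lra.
  apply: le_trans xr _.
  (* 1 + 5 eta <= e^(5 eta) turns the relative displacement into a shift of 5 eta in t. *)
  have -> : - (T - 5 * eta) = ln r + 5 * eta by rewrite /T; ring.
  by rewrite expRD lnK// ler_pM2l// expR_ge1Dx.
have h2 : phi T - phi (T - 5 * eta) <= m * (T - (T - 5 * eta)) by apply: hu; lra.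
by lra.
Qed.

Lemma sphere_min_upper m : (forall e, 0 < e -> exists2 u, 0 < u &
    forall s t, u <= s -> s <= t -> phi t - phi s <= (m + e) * (t - s)) -> 0 <= m ->
  forall e, 0 < e -> exists2 T0, 0 < T0 & forall T, T0 <= T -> phi T <= (m + e) * T.
Proof.
move=> slope m0 e e0; have e20 : 0 < e / 2 by lra.
have [u u0 hu] := slope _ e20.
have pu : 0 <= phi u.
  by apply: (sphere_min_ge0 n2 wc w0); have : 0 < ln 2 :> R by [rewrite ln_gt0// ltr1n]; lra.
have pe : 0 <= phi u / (e / 2) by rewrite divr_ge0// ltW.
(* From this point on the constant phi u is absorbed by the second half of [e]. *)
exists (u + phi u / (e / 2)) => [|T TT]; first by lra.
have h1 : phi T - phi u <= (m + e / 2) * (T - u) by apply: hu; lra.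
have h2 : phi u <= e / 2 * T by rewrite mulrC -ler_pdivrMr//; lra.
have : 0 <= (m + e / 2) * u by apply: mulr_ge0; lra.
by lra.
Qed.

Lemma upper_bound m : 0 <= m ->
  (forall s t, 0 <= s -> s <= t -> m * (t - s) <= phi t - phi s) ->
  (forall e, 0 < e -> exists2 u, 0 < u &
    forall s t, u <= s -> s <= t -> phi t - phi s <= (m + e) * (t - s)) ->
  forall del, 0 < del -> exists2 T0, 0 < T0 & forall c, 0 < enorm c ->
    T0 <= - ln (enorm c) -> w c <= (m + del) * - ln (enorm c).
Proof.
move=> m0 hm slope del del0.
have l2 : 0 < ln 2 :> R by rewrite ln_gt0// ltr1n.
have md0 : 0 < m + del by lra.
have k0 : 0 < del / (m + del) by rewrite divr_gt0.
have k40 : 0 < del / (m + del) / 4 by rewrite divr_gt0.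
have [sig /andP[sig0 sig4] hsig] := spike_width k40.
(* The excess that a spike forces around [c]. The tolerance [kap] and the loss 5 (m + 1) eta of the
   lower bound each take at most a quarter of it, so it exceeds their sum. *)
have [c1 c1E] : exists c1, c1 = ln 2 * (del / (m + del) / 4) by eexists.
have c10 : 0 < c1 by rewrite c1E mulr_gt0.
have kap0 : 0 < c1 / 4 by rewrite divr_gt0.
have [eta [eta0 eta20 etac]] : exists eta, [/\ 0 < eta, eta <= 1 / 20 &
    5 * (m + 1) * eta <= c1 / 4].
  have m20 : 0 < 20 * (m + 1) by lra.
  exists (Num.min (1 / 20) (c1 / (20 * (m + 1)))); split.
  - by rewrite lt_min divr_gt0 //= divr_gt0.
  - by rewrite ge_min lexx.
  - set eta := Num.min _ _.
    have : eta * (20 * (m + 1)) <= c1 by rewrite -ler_pdivlMr// ge_min lexx orbT.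
    by lra.
have eta1 : eta < 1 by lra.
have [T1 T10 near] := near_min n2 wc ws w0 winf m0 kap0 eta0 eta1 hm slope.
have [u u0 hu] := slope 1 ltr01.
have del40 : 0 < del / 4 by lra.
have [T2 T20 phi_le] := sphere_min_upper slope m0 del40.
have [sl slE] : exists sl, sl = ln 8 - ln sig by eexists.
have sl0 : 0 <= sl by rewrite slE subr_ge0 ler_ln ?posrE//; lra.
have p2 : 0 <= (1 + sl) / (m + del) by rewrite divr_ge0 ?(ltW md0)//; lra.
(* The last summand makes (m + del) T >= 1 + sl, hence w c >= 1 and sl <= w x0. *)
exists (T1 + u + 1 + T2 + (1 + sl) / (m + del)) => [|c c0 TT]; first by lra.
have r1 : enorm c < 1 by rewrite -ltr_ln ?posrE// ln1; lra.
have wA := near_sphere_min_le hu u0 eta0 eta20 c0 r1.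
have {}near := near c c0.
set T := - ln (enorm c) in TT wA near *.
have [TT1 Tu TT2 TTs] : [/\ T1 <= T, u + 1 <= T, T2 <= T & (1 + sl) / (m + del) <= T].
  by move: TT p2 T10 u0 T20; clear; move=> *; split; lra.
have {}phi_le := phi_le T TT2.
have Tpos : 0 < T by exact: lt_le_trans TT1.
move: TTs; rewrite ler_pdivrMr// => Tq.
rewrite leNgt; apply/negP => big.
have [xb xbc wxb] := near TT1.
have {near} {}wA := wA Tu.
clear hm slope hu T10 T20 u0 TT TT1 TT2 Tu p2 kap0 eta1 k0 k40 del40.
set rho := eta * enorm c in wA xbc.
have rho0 : 0 < rho by rewrite mulr_gt0.
have rho1 : rho <= 1.
  by apply: le_trans (_ : eta * 1 <= 1); [rewrite ler_pM2l// ltW|lra].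
have wc1 : 1 <= w c by move: big Tq sl0; rewrite mulrC; lra.
have [|x0 [x0c wx0 flat]] := hsig c rho rho0 rho1 wc1.
  by move=> x xc; apply: (wA x _).1; lra.
set W0 := w x0 in wx0 flat.
have WT : (m + del) * T <= W0 by apply: le_trans (ltW big) wx0.
have W01 : 1 <= W0 by exact: le_trans wx0.
have slW : sl <= W0 by move: WT Tq; rewrite mulrC; lra.
have sh0 : 0 <= 5 * (m + 1) * eta by rewrite mulr_ge0 ?(ltW eta0)//; lra.
have [AB gap] := spike_gap_large m0 del0 (ltW Tpos) WT W01 phi_le sh0 sl0 slW (ltW l2).
clear big Tq WT phi_le slW hsig wx0 wc1 r1 rho1 md0.
have ex0 : 0 < expR (- W0) by exact: expR_gt0.
have ex1 : expR (- W0) <= 1 by rewrite -expR0 ler_expR oppr_le0; exact: le_trans ler01 _.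
have lam0 : 0 < rho * expR (- W0) / 2 by rewrite divr_gt0// mulr_gt0.
have lam_rho : rho * expR (- W0) / 2 <= rho.
  have : rho * expR (- W0) <= rho * 1 by rewrite ler_pM2l.
  by lra.
set s := sig * _ in flat.
have s0 : 0 < s by rewrite mulr_gt0.
have srho : s <= rho.
  apply: le_trans lam_rho; rewrite /s ger_pMl//.
  by apply: le_trans sig4 _; rewrite ler_pdivrMr// mul1r ler1n.
have := spike_gap s0 srho x0c AB wA flat xbc.
have -> : ln (4 * rho) - ln s = W0 + sl.
  have l8 : ln 8 = ln 4 + ln 2 :> R by rewrite -lnM ?posrE//; congr ln; ring.
  rewrite slE /s l8 [ln (sig * _)]lnM ?posrE//.
  rewrite [ln (_ / 2)]lnM ?posrE ?invr_gt0 ?mulr_gt0// lnV ?posrE//.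
  rewrite [ln (rho * _)]lnM ?posrE// expRK [ln (4 * _)]lnM ?posrE//.
  by ring.
move: gap wxb etac c10; rewrite -c1E -/T.
by lra.
Qed.

End UpperBound.

(** * Conclusion *)

Unset Implicit Arguments.

Theorem theorem1p2 (R : realType) (n : nat) (hn : (2 <= n)%N)
  (w : 'rV[R]_n -> R) (f : 'rV[R]_n -> R -> 'rV[R]_n -> R) (C : R) :
  C2_on (pball 2) w ->
  (forall x, pball 2 x -> 0 <= w x) ->
  (forall x, pball 2 x -> nlap_defined w x /\ - nlap w x = f x (w x) (grad w x)) ->
  (forall x, pball 2 x ->
     0 <= f x (w x) (grad w x) <=
       C * enorm (grad w x) ^+ (n - 2) * expR (2 * w x)) ->
  w x @[x --> (0 : 'rV[R]_n)^'] --> +oo ->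
  exists m : R, 0 <= m /\
    (w x / ln (enorm x)^-1) @[x --> (0 : 'rV[R]_n)^'] --> m /\
    exists L : R, forall x, pball 1 x -> m * ln (enorm x)^-1 - L <= w x.
Proof.
move=> Cw w0 wf fb winf.
have wc x : pball 2 x -> {for x, continuous w}.
  by move=> /Cw[dw _]; exact: differentiable_continuous.
(* Where the gradient is nonzero, |grad w|^(n - 2) cancels from the equation and from the bound on
   f. The sign of [C] is not given, so |C| replaces it. *)
have wb x : pball 2 x -> bounded_sol (`|C| * expR (2 * w x)) w x.
  move=> x2; exists (grad w x), (hess w x); split.
    exact: C2_has_jet (@open_pball R n 2) Cw x2.
  move=> p0; have e0 : 0 < enorm (grad w x) ^+ (n - 2).
    by rewrite exprn_gt0// enorm_gt0.
  have := fb x x2; have [_ <-] := wf x x2.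
  rewrite (nlap_nop (@open_pball R n 2) Cw x2 p0) oppr_ge0 pmulr_rle0// => /andP[h1 h2].
  rewrite h1 andbT lerNl -(ler_pM2l e0) mulrN; apply: le_trans h2 _.
  by rewrite mulrAC mulrC ler_pM2l// ler_wpM2r ?expR_ge0 ?ler_norm.
have ws x (x2 : pball 2 x) : supersol w x := bounded_sol_supersol (wb x x2).
have near0 (P : 'rV[R]_n -> Prop) d : 0 < d -> (forall x, 0 < enorm x < d -> P x) ->
    \forall x \near (0 : 'rV[R]_n)^', P x.
  move=> d0 H; have : \forall x \near (0 : 'rV[R]_n), enorm (x - 0) < d.
    apply: (open_nbhs_nbhs (A := [set x | enorm (x - 0) < d])); split.
      exact: open_enorm_lt.
    by rewrite /= subrr enorm0.
  apply: filterS => x; rewrite subr0 => xd xN0; apply: H.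
  by rewrite enorm_gt0 xN0.
have wi A : exists2 d, 0 < d & forall x, 0 < enorm x < d -> A <= w x.
  have /cvgryPge/(_ A) := winf.
  move=> /nbhs_norm0P[d /= d0 H].
  exists d => // x /andP[x0 xd]; apply: H; last by rewrite -enorm_gt0.
  exact: le_lt_trans (normr_le_enorm x) xd.
have l2 : - ln 2 < 0 :> R by rewrite oppr_lt0 ln_gt0// ltr1n.
have [m [m0 hm slope]] := concave_asymptotic_slope l2
  (sphere_min_ge0 hn wc w0) (sphere_min_slope hn wc ws).
have lower x : pball 1 x -> m * - ln (enorm x) <= w x.
  move=> /andP[x0 x1].
  have l0 : 0 <= - ln (enorm x) by rewrite oppr_ge0 ln_le0// ltW.
  have x2 : pball 2 x by rewrite /pball /= x0 /=; lra.
  apply: le_trans (sphere_min_le hn wc x2).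
  have := hm 0 _ (lexx 0) l0; have := sphere_min_ge0 hn wc w0 l2.
  by lra.
exists m; split=> //; split; last first.
  exists 0 => x x1; rewrite subr0; have /andP[x0 _] := x1.
  by rewrite lnV ?posrE//; exact: lower.
apply/cvgrPdist_le => e e0.
have [T0 T00 HT] := upper_bound (normr_ge0 C) hn wc wb w0 wi m0 hm slope e0.
apply: (near0 _ (expR (- T0))); first exact: expR_gt0.
move=> x /andP[x0 xT].
have lT : T0 < - ln (enorm x) by rewrite ltrNr -ltr_expR lnK.
have l0 : 0 < - ln (enorm x) by exact: lt_trans lT.
have x1 : pball 1 x.
  by rewrite /pball /= x0 /= -[ltRHS]expR0; apply: lt_trans xT _; rewrite ltr_expR; lra.
rewrite lnV ?posrE// distrC ler_distl ler_pdivlMr// ler_pdivrMr//.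
have h1 := lower x x1; have h2 := HT x x0 (ltW lT).
rewrite h2 andbT; apply: le_trans h1; rewrite ler_wpM2r ?(ltW l0)//; lra.
Qed.
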